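(* Let $Z$ be a set of double points in $\mathbb{P}^1\times\mathbb{P}^1$ with ACM support $X$, let $\lambda=(\lambda_1,\ldots,\lambda_r)=\alpha_X$, and let $\mathcal{C}$, $p=|\mathcal{C}|$, $F_\ell$, $I_\ell$ and $\mathcal{M}_\ell$ be as defined in the context. Let $1\le \ell\le p$, let $(i,j)=(i_\ell,j_\ell)$ be the $\ell$th largest element of $\mathcal{C}$ with respect to the lexicographic order, and suppose that $$0\rightarrow \mathbb{F}_2\rightarrow\mathbb{F}_1\rightarrow\mathbb{F}_0\rightarrow I_{\ell-1}\rightarrow 0$$ is the bigraded minimal free resolution of $I_{\ell-1}$. Write $m_{a,b}=(\mathcal{M}_{\ell-1})_{a,b}$ and set $$u_{i,j}=m_{1,j}+m_{2,j}+\cdots+m_{i-1,j},\qquad v_{i,j}=m_{i,1}+m_{i,2}+\cdots+m_{i,j-1},$$ $$a_{i,j}=m_{i,j}+\cdots+m_{r,j},\qquad b_{i,j}=m_{i,j}+\cdots+m_{i,\lambda_1}.$$ Then $I_\ell=(I_{\ell-1},F_\ell)$ has a bigraded minimal free resolution of the form $$0\rightarrow \mathbb{F}_2\oplus S(-u_{i,j}-a_{i,j},-v_{i,j}-b_{i,j})\rightarrow \mathbb{F}_1\oplus S(-u_{i,j}-a_{i,j},-v_{i,j})\oplus S(-u_{i,j},-v_{i,j}-b_{i,j})\rightarrow \mathbb{F}_0\oplus S(-u_{i,j},-v_{i,j})\rightarrow I_\ell\rightarrow 0.$$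
   Context: $k$ is an algebraically closed field of characteristic zero, and $S=k[x_0,x_1,y_0,y_1]$ is $\mathbb{N}^2$-graded with $\deg x_i=(1,0)$, $\deg y_i=(0,1)$; it is the coordinate ring of $\mathbb{P}^1\times\mathbb{P}^1$. A point $P=R\times Q\in\mathbb{P}^1\times\mathbb{P}^1$ has defining ideal $I_P=(L_R,L_Q)$, where $L_R$ (degree $(1,0)$) and $L_Q$ (degree $(0,1)$) are linear forms vanishing at $R$, resp. $Q$. For a finite set $X$ of points with positive multiplicities $m_P$, the fat point scheme $\{(P;m_P)\}$ has defining ideal $\bigcap_{P\in X}I_P^{m_P}$ and support $X$; it is a set of double points if all $m_P=2$. A set of points $X$ with defining ideal $I_X$ is arithmetically Cohen-Macaulay (ACM) if $S/I_X$ is Cohen-Macaulay. For a finite set of points $X$, let $\pi_1,\pi_2$ be the projections to the two factors, $\pi_1(X)=\{R_1,\ldots,R_r\}$, $\pi_2(X)=\{Q_1,\ldots,Q_t\}$. The partition $\alpha_X$ lists the numbers $|\{P\in X : \pi_1(P)=R_i\}|$, $i=1,\dots,r$, in non-increasing order. Let $Z$ be a set of double points with ACM support $X$ and $\lambda=(\lambda_1,\ldots,\lambda_r)=\alpha_X$. Then $t=\lambda_1$, and one relabels the $R_i$ and $Q_j$ so that $X=\{R_i\times Q_j : 1\le i\le r,\ 1\le j\le\lambda_i\}$ (a Ferrers diagram of $\lambda$; this is always possible when $X$ is ACM). The completion of $Z$ is $Y=Z\cup(W\setminus X)$, where $W=\{R_i\times Q_j : 1\le i\le r,1\le j\le \lambda_1\}$;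 i.e. $Y$ has multiplicity $2$ at points of $X$ and $1$ at points of $W\setminus X$, with defining ideal $I_Y$. The degree matrix $\mathcal{M}_\lambda$ is the $r\times\lambda_1$ matrix with $(\mathcal{M}_\lambda)_{i,j}=2$ if $j\le\lambda_i$ and $1$ otherwise. The base corners are $\mathcal{C}_0=\{(i,j) : (\mathcal{M}_\lambda)_{i,j}=1,\ (\mathcal{M}_\lambda)_{i-1,j}=(\mathcal{M}_\lambda)_{i,j-1}=2\}$ (equivalently $\{(i,\lambda_i+1) : 2\le i\le r,\ \lambda_i<\lambda_{i-1}\}$); $\mathcal{C}_1=\{(i,l) : (i,j),(k,l)\in\mathcal{C}_0,\ i>k\}$; the corners are $\mathcal{C}=\mathcal{C}_0\cup\mathcal{C}_1=\{(i_1,j_1),\ldots,(i_p,j_p)\}$, ordered from largest to smallest in lexicographic order. The form relative to the corner $(i,j)=(i_\ell,j_\ell)$ is $$F_\ell=L_{R_1}^{n_{1,j}}\cdots L_{R_{i-1}}^{n_{i-1,j}}L_{Q_1}^{n_{i,1}}\cdots L_{Q_{j-1}}^{n_{i,j-1}},\qquad n_{a,b}=(\mathcal{M}_\lambda)_{a,b}.$$ Set $I_0=I_Y$ and $I_\ell=(I_{\ell-1},F_\ell)$ for $\ell=1,\ldots,p$. Let $\succeq$ be the partial order with $(a,b)\succeq(c,d)$ iff $a\ge c$ and $b\ge d$. Set $\mathcal{M}_0=\mathcal{M}_\lambda$ and, for $\ell=1,\ldots,p$, let $\mathcal{M}_\ell$ be the $r\times\lambda_1$ matrix with $(\mathcal{M}_\ell)_{a,b}=0$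 if $(a,b)\succeq(i_\ell,j_\ell)$ and $(\mathcal{M}_\ell)_{a,b}=(\mathcal{M}_{\ell-1})_{a,b}$ otherwise. *)

(* Defs.v *)
From HB Require Import structures.
From mathcomp Require Import all_boot all_order all_algebra.
From mathcomp Require Import finmap.
From mathcomp.multinomials Require Import mpoly.

Set Implicit Arguments.
Unset Strict Implicit.
Unset Printing Implicit Defensive.

Import GRing.Theory.
Local Open Scope ring_scope.

Section Ideals.
Variable A : comNzRingType.
Implicit Types (I J : A -> Prop).

Definition ideal_gen (G : A -> Prop) : A -> Prop := fun f =>
  exists (n : nat) (c g : 'I_n -> A),
    (forall i, G (g i)) /\ f = \sum_(i < n) c i * g i.

Definition ideal_pow I (m : nat) : A -> Prop :=
  ideal_gen (fun f => exists g : 'I_m -> A,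
    (forall i, I (g i)) /\ f = \prod_(i < m) g i).

(* The ideal (I, f). *)
Definition ideal_ext I (f : A) : A -> Prop := ideal_gen (fun g => I g \/ g = f).

Definition is_ideal I : Prop :=
  [/\ I 0, forall f g, I f -> I g -> I (f + g) & forall c f, I f -> I (c * f)].

Definition prime_ideal I : Prop :=
  [/\ is_ideal I, ~ I 1 & forall f g, I (f * g) -> I f \/ I g].

Definition maximal_ideal I : Prop :=
  [/\ is_ideal I, ~ I 1 &
      forall J, is_ideal J -> ~ J 1 -> (forall f, I f -> J f) ->
                forall f, J f -> I f].

Definition strictly_below I J : Prop :=
  (forall f, I f -> J f) /\ exists f, J f /\ ~ I f.

(* A chain of d + 1 primes of A / I ending at N / I; primes of A / I are
   written as primes of A containing I. *)
Definition prime_chain I N (d : nat) : Prop :=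
  exists p : nat -> A -> Prop,
    [/\ forall i, (i <= d)%N -> prime_ideal (p i) /\ (forall f, I f -> p i f),
        forall i, (i < d)%N -> strictly_below (p i) (p i.+1) &
        forall f, p d f <-> N f].

Definition codim_is I N (d : nat) : Prop :=
  prime_chain I N d /\ forall e, prime_chain I N e -> (e <= d)%N.

(* [s] is a regular sequence on A / I. *)
Fixpoint regular_seq I (s : seq A) : Prop :=
  if s is f :: s' then (forall g, I (f * g) -> I g) /\ regular_seq (ideal_ext I f) s'
  else ~ I 1.

Definition regular_in I N (d : nat) : Prop :=
  exists s : seq A, [/\ size s = d, {in s, forall f, N f} & regular_seq I s].

(* depth of N / I: greatest length of an A / I-regular sequence in N. *)
Definition depth_is I N (d : nat) : Prop :=
  regular_in I N d /\ forall e, regular_in I N e -> (e <= d)%N.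

(* A / I is Cohen-Macaulay (A Noetherian): depth and codimension agree at every
   maximal ideal of A / I. *)
Definition CohenMacaulay_quotient I : Prop :=
  forall N, maximal_ideal N -> (forall f, I f -> N f) ->
    exists d : nat, depth_is I N d /\ codim_is I N d.

End Ideals.

Section Geometry.
Variable k : closedFieldType.

(* S = k[x_0, x_1, y_0, y_1]: the first two variables are x_0, x_1, the last two
   are y_0, y_1. *)
Definition S := {mpoly k[2 + 2]}.
Definition x_ (i : 'I_2) : S := 'X_(lshift 2 i).
Definition y_ (i : 'I_2) : S := 'X_(rshift 2 i).

Definition irrelevant : S -> Prop := ideal_gen (fun f => exists i, f = 'X_i).

(* Degrees are taken in Z^2 so that arbitrary shifts S(-a, -b) make sense. *)
Definition bideg (m : 'X_{1.. 2 + 2}) : int * int :=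
  ((\sum_(i < 2) m (lshift 2 i))%N%:Z, (\sum_(i < 2) m (rshift 2 i))%N%:Z).

Definition bihomog (d : int * int) (f : S) : Prop :=
  {in msupp f, forall m, bideg m = d}.

(* A tuple [D] of bidegrees (a_i, b_i) stands for the graded free module
   F = (+)_i S(-a_i, -b_i); [free_bihomog D d v] says that v lies in F_d. *)
Definition free_bihomog n (D : n.-tuple (int * int)) (d : int * int)
    (v : 'rV[S]_n) : Prop :=
  forall i, bihomog (d - tnth D i) (v 0 i).

Definition free_sum n p (D : n.-tuple (int * int)) (E : p.-tuple (int * int)) :
  (n + p).-tuple (int * int) := cat_tuple D E.

(* S(-a, -b) *)
Definition twist (a b : nat) : 1.-tuple (int * int) := [tuple (a%:Z, b%:Z)].

Definition graded_map n p (D : n.-tuple (int * int)) (E : p.-tuple (int * int))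
    (phi : 'rV[S]_n -> 'rV[S]_p) : Prop :=
  forall d v, free_bihomog D d v -> free_bihomog E d (phi v).

Definition minimal_map n p (phi : 'rV[S]_n -> 'rV[S]_p) : Prop :=
  forall v i, irrelevant (phi v 0 i).

(* There is a bigraded minimal free resolution
     0 -> F2 -d2-> F1 -d1-> F0 -e-> I -> 0. *)
Definition minimal_free_resolution n2 n1 n0
    (F2 : n2.-tuple (int * int)) (F1 : n1.-tuple (int * int))
    (F0 : n0.-tuple (int * int)) (I : S -> Prop) : Prop :=
  exists (e : {linear 'rV[S]_n0 -> S^o})
         (d1 : {linear 'rV[S]_n1 -> 'rV[S]_n0})
         (d2 : {linear 'rV[S]_n2 -> 'rV[S]_n1}),
    [/\ [/\ forall d v, free_bihomog F0 d v -> bihomog d (e v),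
            graded_map F1 F0 d1 & graded_map F2 F1 d2],
        [/\ forall f, I f <-> exists v, e v = f,
            forall v, e v = 0 <-> exists w, d1 w = v,
            forall w, d1 w = 0 <-> exists z, d2 z = w &
            injective d2] &
        minimal_map d1 /\ minimal_map d2].

(* P^1(k), each point by its unique representative [1 : c] or [0 : 1]. *)
Definition P1 := {c : k * k | (c.1 == 1) || ((c.1 == 0) && (c.2 == 1))}.

Definition LX (R : P1) : S := (val R).2 *: x_ 0 - (val R).1 *: x_ 1.
Definition LY (Q : P1) : S := (val Q).2 *: y_ 0 - (val Q).1 *: y_ 1.

Definition point_ideal (P : P1 * P1) : S -> Prop :=
  ideal_gen (fun f => f = LX P.1 \/ f = LY P.2).

Definition points_ideal (X : {fset P1 * P1}) : S -> Prop :=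
  fun f => {in X, forall P, point_ideal P f}.

Definition ACM (X : {fset P1 * P1}) : Prop :=
  CohenMacaulay_quotient (points_ideal X).

(* A fat point scheme: the multiplicity of each point, 0 off the support. *)
Definition fat_points := {fsfun P1 * P1 -> nat with 0%N}.

Definition fat_ideal (Z : fat_points) : S -> Prop :=
  fun f => {in finsupp Z, forall P, ideal_pow (point_ideal P) (Z P) f}.

Definition double_points (Z : fat_points) : Prop :=
  {in finsupp Z, forall P, Z P = 2%N}.

Definition alpha (X : {fset P1 * P1}) : seq nat :=
  sort geq [seq #|` [fset P in X | P.1 == R]%fset| | R <- (fst @` X)%fset].

End Geometry.

(* From here on indices of rows and columns start at 0. *)

Notation nrows lam := (size lam).
Notation ncols lam := (head 0%N lam).

Section Combinatorics.
Variable lam : seq nat.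
Notation r := (nrows lam).
Notation t := (ncols lam).

Definition degree_mx : 'M[nat]_(r, t) :=
  \matrix_(i, j) (if (j < nth 0 lam i)%N then 2%N else 1%N).

Definition base_corners : {set 'I_r * 'I_t} :=
  [set c | [&& degree_mx c.1 c.2 == 1%N,
     [exists i : 'I_r, (i.+1 == c.1 :> nat) && (degree_mx i c.2 == 2%N)] &
     [exists j : 'I_t, (j.+1 == c.2 :> nat) && (degree_mx c.1 j == 2%N)]]].

Definition corners1 : {set 'I_r * 'I_t} :=
  [set c | [exists j : 'I_t, [exists i : 'I_r,
     [&& (c.1, j) \in base_corners, (i, c.2) \in base_corners & (i < c.1)%N]]]].

Definition lex_ge (c d : 'I_r * 'I_t) : bool :=
  (d.1 < c.1)%N || ((d.1 == c.1) && (d.2 <= c.2)%N).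

Definition corners : seq ('I_r * 'I_t) :=
  sort lex_ge (enum (base_corners :|: corners1)).

(* [corner l] is the (l + 1)-th largest corner. *)
Definition corner (l : 'I_(size corners)) : 'I_r * 'I_t := tnth (in_tuple corners) l.

(* The matrix after the l largest corners have been processed. *)
Definition deg_mx (l : nat) : 'M[nat]_(r, t) :=
  foldl (fun (M : 'M[nat]_(r, t)) (c : 'I_r * 'I_t) =>
           \matrix_(a, b) (if (c.1 <= a)%N && (c.2 <= b)%N then 0%N else M a b))
    degree_mx (take l corners).

Variables (k : closedFieldType) (R : 'I_r -> P1 k) (Q : 'I_t -> P1 k).

Definition ferrers_labelling (X : {fset P1 k * P1 k}) : Prop :=
  [/\ injective R, injective Q &
      forall P : P1 k * P1 k, (P \in X) =
        [exists i : 'I_r, exists j : 'I_t, (j < nth 0 lam i)%N && (P == (R i, Q j))]].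

(* Z together with the remaining points of the grid, with multiplicity 1. *)
Definition completion (Z : fat_points k) : fat_points k :=
  [fsfun P in ((R @` 'I_r) `*` (Q @` 'I_t))%fset =>
     if P \in finsupp Z then Z P else 1%N | 0%N].

Definition corner_form (c : 'I_r * 'I_t) : S k :=
  (\prod_(a < r | (a < c.1)%N) LX (R a) ^+ degree_mx a c.2) *
  (\prod_(b < t | (b < c.2)%N) LY (Q b) ^+ degree_mx c.1 b).

(* The ideal I_l, obtained from I_Y by adding the forms of the l largest corners. *)
Definition corner_ideal (Z : fat_points k) (l : nat) : S k -> Prop :=
  foldl (fun J c => ideal_ext J (corner_form c)) (fat_ideal (completion Z))
    (take l corners).

End Combinatorics.

(* Main.v *)
From HB Require Import structures.
Require Import Defs.
From mathcomp Require Import all_boot all_order all_algebra.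
From mathcomp Require Import finmap ring zify.
From mathcomp.multinomials Require Import mpoly.

Set Implicit Arguments.
Unset Strict Implicit.
Unset Printing Implicit Defensive.

Import GRing.Theory.
Local Open Scope ring_scope.

(** Write I for the ideal I_(l-1), F for the form of the corner (i, j), and
    I' = (I, F).  Multiplication by F maps S/(I : F), shifted by the degree of F,
    isomorphically onto I'/I, so a mapping cone glues the resolution of I and the
    Koszul resolution of S/(I : F) to a resolution of I', provided that I : F is a complete
    intersection (A, B) with A a form in the x's and B a form in the y's of
    degrees a and b.  Two things need an argument: the colon ideal, and the
    minimality of the cone.

    Both come from a picture.  A corner takes its column from one base corner and
    its row from the same or from a lower one.  So, once all larger corners have
    cleared everything below and to the right of them, the entries still equal to 1
    below and to the right of (i, j) form a rectangle [i, i') x [j, j').  Here i'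
    is the next row with a corner in column j, or the number of rows, and j' is likewise the next column with a corner in row i, or
    the number of columns ([corner_rectangle]).  Let A and B be the products of
    the lines of the rows and of the columns of that rectangle.

    The colon ideal: I vanishes at the points of the rectangle and F at none of
    them, so an element of I : F vanishes on the whole grid of the rectangle,
    whose ideal is (A, B) ([points_on_grid]).  Conversely A F and B F lie in I, by
    the factorizations below.

    Minimality: let Phi(c, d) be the form that the recipe for F attaches to any
    position (c, d) ([grid_form]).  The degree matrix decreases in both
    directions, so F = (p f)(q g) with p, f in the x's and q, g in the y's, such
    that
      Phi(i', j) = p f A q,  Phi(i, j') = p q g B,  Phi(i', j') = p A q B.
    All three lie in I, either because the position is an earlier corner or, on
    the border of the grid, because the form already lies in I_Y
    ([outer_form_fat]).  Moreover f and g are not constant, since the degree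
    matrix really drops between consecutive corners.  Hence A F = g Phi(i', j) and
    B F = f Phi(i, j') have lifts to F_0 with entries in the irrelevant ideal.  The
    syzygy B (A F) - A (B F) is handled in the same way, because it factors through
    the third form:
      B g Phi(i', j) - A f Phi(i, j')
        = g (B Phi(i', j) - f Phi(i', j')) + f (g Phi(i', j') - A Phi(i, j')),
    and both brackets are syzygies.  Thus every entry of the comparison map of the
    cone is irrelevant ([resolution_add_corner]), whatever the minimal resolution
    of I one started from. *)

(** * Ideals *)

Section IdealFacts.
Variable A : comNzRingType.
Implicit Types (I J G : A -> Prop) (f g c : A).

Lemma ideal_gen_is_ideal G : is_ideal (ideal_gen G).
Proof.
split=> [|f g [n [c [g1 [G1 ->]]]] [p [c' [g2 [G2 ->]]]]|c f [n [c' [g [Gg ->]]]]].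
- exists 0%N, (fun=> 0), (fun=> 0); split; first by case.
  by rewrite big_ord0.
- exists (n + p)%N.
  exists (fun i => match split i with inl i1 => c i1 | inr i2 => c' i2 end).
  exists (fun i => match split i with inl i1 => g1 i1 | inr i2 => g2 i2 end).
  split=> [i|]; first by case: (split i).
  rewrite big_split_ord; congr (_ + _); apply: eq_bigr => i _.
  + by rewrite -[lshift p i]/(unsplit (inl i)) unsplitK.
  + by rewrite -[rshift n i]/(unsplit (inr i)) unsplitK.
- exists n, (fun i => c * c' i), g; split=> //.
  by rewrite mulr_sumr; apply: eq_bigr => i _; rewrite mulrA.
Qed.

Lemma mem_ideal_gen G g : G g -> ideal_gen G g.
Proof.
move=> Gg; exists 1%N, (fun=> 1), (fun=> g); split=> //.
by rewrite big_ord1 mul1r.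
Qed.

Lemma ideal_gen_min G I :
  is_ideal I -> (forall g, G g -> I g) -> forall f, ideal_gen G f -> I f.
Proof.
move=> [I0 ID IM] GI f [n [c [g [Gg ->]]]].
by elim/big_ind: _ => // i _; apply/IM/GI.
Qed.

Lemma ideal_ext_is_ideal I f : is_ideal (ideal_ext I f).
Proof. exact: ideal_gen_is_ideal. Qed.

Lemma sub_ideal_ext I f g : I g -> ideal_ext I f g.
Proof. by move=> Ig; apply: mem_ideal_gen; left. Qed.

Lemma mem_ideal_ext I f : ideal_ext I f f.
Proof. by apply: mem_ideal_gen; right. Qed.

Lemma ideal_pow1 I f : I f -> ideal_pow I 1 f.
Proof.
move=> If; apply: mem_ideal_gen; exists (fun=> f); split=> //.
by rewrite big_ord1.
Qed.

Lemma mul_ideal_pow2 I f g : I f -> I g -> ideal_pow I 2 (f * g).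
Proof.
move=> If Ig; apply: mem_ideal_gen.
exists (fun i : 'I_2 => if val i == 0%N then f else g); split=> [i|].
  by case: ifP.
by rewrite big_ord_recl big_ord1.
Qed.

Lemma ideal_pow_sub I m f : is_ideal I -> (0 < m)%N -> ideal_pow I m f -> I f.
Proof.
move=> idI; case: m => // m _; apply: ideal_gen_min => // _ [g [Ig ->]].
by rewrite big_ord_recl mulrC; case: idI => _ _; apply.
Qed.

End IdealFacts.

(** * The bigrading *)

Definition bd (a b : nat) : int * int := (a%:Z, b%:Z).

Lemma bdD a b a' b' : bd a b + bd a' b' = bd (a + a') (b + b').
Proof. by rewrite /bd !PoszD. Qed.

Lemma bdMn a b n : bd a b *+ n = bd (a * n) (b * n).
Proof.
elim: n => [|n IHn]; first by rewrite !muln0.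
by rewrite mulrS IHn bdD !mulnS.
Qed.

Section Bigrading.
Variable k : closedFieldType.
Implicit Types (f g : S k) (d : int * int).

Lemma bideg_add m1 m2 : bideg (m1 + m2)%MM = bideg m1 + bideg m2.
Proof.
by rewrite /bideg; congr (_, _); rewrite -PoszD -big_split /=;
  congr Posz; apply: eq_bigr => i _; rewrite mnmDE.
Qed.

Lemma irrelevantD f g : irrelevant f -> irrelevant g -> irrelevant (f + g).
Proof.
by have [_ irrD _] : is_ideal (@irrelevant k); [apply: ideal_gen_is_ideal | apply: irrD].
Qed.

Lemma irrelevantM f g : irrelevant g -> irrelevant (f * g).
Proof.
by have [_ _ irrM] : is_ideal (@irrelevant k); [apply: ideal_gen_is_ideal | apply: irrM].
Qed.

Lemma irrelevantN f : irrelevant f -> irrelevant (- f).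
Proof. by move=> hf; rewrite -mulN1r; apply: irrelevantM. Qed.

Lemma bihomog0 d : bihomog d (0 : S k).
Proof. by move=> m; rewrite msupp0. Qed.

Lemma bihomogD d f g : bihomog d f -> bihomog d g -> bihomog d (f + g).
Proof.
move=> hf hg m /msuppD_le; rewrite mem_cat => /orP[]; first exact: hf.
exact: hg.
Qed.

Lemma bihomogN d f : bihomog d f -> bihomog d (- f).
Proof. by move=> hf m; rewrite (perm_mem (msuppN _)); apply: hf. Qed.

Lemma bihomogM d1 d2 f g : bihomog d1 f -> bihomog d2 g -> bihomog (d1 + d2) (f * g).
Proof.
move=> hf hg m /msuppM_le /allpairsP[[m1 m2] /= [m1f m2g ->]].
by rewrite bideg_add (hf _ m1f) (hg _ m2g).
Qed.

Lemma bihomogZ d (a : k) f : bihomog d f -> bihomog d (a *: f).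
Proof. by move=> hf m /msuppZ_le; apply: hf. Qed.

Definition bipart d f : S k := \sum_(m <- msupp f | bideg m == d) f@_m *: 'X_[m].

Lemma mcoeff_bipart d f m :
  (bipart d f)@_m = if bideg m == d then f@_m else 0.
Proof.
rewrite /bipart raddf_sum /= (eq_bigr (fun m' => f@_m' * (m' == m)%:R)); last first.
  by move=> m' _; rewrite mcoeffZ mcoeffX.
have [mf|mf] := boolP (m \in msupp f); last first.
  rewrite (memN_msupp_eq0 mf) if_same big_seq_cond big1 // => m' /andP[m'f _].
  by case: eqP => [e|_]; rewrite ?mulr0 //; rewrite e (negPf mf) in m'f.
rewrite big_mkcond (bigD1_seq m) //= eqxx mulr1 big1 ?addr0 //.
by move=> m' /negPf ->; rewrite mulr0 if_same.
Qed.

Lemma bipart_bihomog d f : bihomog d (bipart d f).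
Proof.
move=> m; rewrite mcoeff_msupp mcoeff_bipart.
by have [//|_] := eqVneq (bideg m) d; rewrite eqxx.
Qed.

Lemma bipartD d f g : bipart d (f + g) = bipart d f + bipart d g.
Proof.
apply/mpolyP=> m; rewrite mcoeffD !mcoeff_bipart mcoeffD.
by case: ifP; rewrite ?addr0.
Qed.

Lemma bipart_homog d0 d f : bihomog d0 f -> bipart d f = if d0 == d then f else 0.
Proof.
move=> hf; apply/mpolyP=> m; rewrite mcoeff_bipart.
have [mf|mf] := boolP (m \in msupp f).
  by rewrite (hf _ mf); case: ifP => //; rewrite mcoeff0.
by rewrite (memN_msupp_eq0 mf) if_same; case: ifP; rewrite ?mcoeff0 ?memN_msupp_eq0.
Qed.

Variables (n : nat) (D : n.-tuple (int * int)).

Lemma free_bihomogD d (v w : 'rV[S k]_n) :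
  free_bihomog D d v -> free_bihomog D d w -> free_bihomog D d (v + w).
Proof. by move=> hv hw i; rewrite mxE; apply: bihomogD. Qed.

Lemma free_bihomogN d (v : 'rV[S k]_n) : free_bihomog D d v -> free_bihomog D d (- v).
Proof. by move=> hv i; rewrite mxE; apply: bihomogN. Qed.

Lemma free_bihomogZ d1 d2 f (v : 'rV[S k]_n) :
  bihomog d1 f -> free_bihomog D d2 v -> free_bihomog D (d1 + d2) (f *: v).
Proof. by move=> hf hv i; rewrite mxE -addrA; apply: bihomogM. Qed.

Definition free_bipart d (v : 'rV[S k]_n) : 'rV[S k]_n :=
  \row_i bipart (d - tnth D i) (v 0 i).

Lemma free_bipart_bihomog d v : free_bihomog D d (free_bipart d v).
Proof. by move=> i; rewrite mxE; apply: bipart_bihomog. Qed.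

Lemma free_bipartD d v w : free_bipart d (v + w) = free_bipart d v + free_bipart d w.
Proof. by apply/rowP=> i; rewrite !mxE bipartD. Qed.

Lemma free_bipart_homog d0 d v :
  free_bihomog D d0 v -> free_bipart d v = if d0 == d then v else 0.
Proof.
move=> hv; apply/rowP=> i; rewrite mxE (bipart_homog _ (hv i)).
by rewrite (can_eq (addrK _)); case: ifP; rewrite ?mxE.
Qed.

(** Taking components commutes with a graded map because both sides are additive
    and every vector is a sum of homogeneous ones.  The shift [s] allows [phi] to
    be a coordinate of a graded map between free modules. *)
Lemma bipart_graded (phi : 'rV[S k]_n -> S k) s :
  {morph phi : v w / v + w} ->
  (forall d v, free_bihomog D d v -> bihomog (d - s) (phi v)) ->
  forall d v, bipart (d - s) (phi v) = phi (free_bipart d v).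
Proof.
move=> phiD phi_gr d.
have phi0 : phi 0 = 0 by apply: (addrI (phi 0)); rewrite -phiD !addr0.
pose P v := bipart (d - s) (phi v) = phi (free_bipart d v).
have PD v w : P v -> P w -> P (v + w).
  by rewrite /P phiD bipartD free_bipartD phiD => -> ->.
have Phom d0 v : free_bihomog D d0 v -> P v.
  move=> hv; rewrite /P (bipart_homog _ (phi_gr _ _ hv)) (free_bipart_homog _ hv).
  by rewrite (can_eq (addrK _)); case: ifP.
have P0 : P 0 by apply: (Phom 0) => i; rewrite mxE; apply: bihomog0.
move=> v; rewrite -/(P v) [v]row_sum_delta; elim/big_ind: _ => // i _.
elim/mpolyind: (v 0 i) => [|c m p _ _ Pp]; first by rewrite scale0r.
rewrite scalerDl; apply: PD => //.
apply: (Phom (bideg m + tnth D i)) => j; rewrite !mxE.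
have [->|] := eqVneq j i; last by rewrite /= mulr0 => _; apply: bihomog0.
rewrite mulr1 addrK; apply: bihomogZ => m'.
by rewrite msuppX mem_seq1 => /eqP ->.
Qed.

End Bigrading.

(** Homogeneous elements of the image of a graded map have homogeneous preimages:
    take the component of the right bidegree of any preimage. *)
Section HomogeneousLifts.
Variables (k : closedFieldType) (n p : nat).
Variables (D : n.-tuple (int * int)) (E : p.-tuple (int * int)).

Lemma homog_lift_ideal (e : {linear 'rV[S k]_n -> (S k)^o}) d v :
  (forall d v, free_bihomog D d v -> bihomog d (e v : S k)) ->
  bihomog d (e v : S k) -> exists2 v', free_bihomog D d v' & e v' = e v.
Proof.
move=> e_gr hv; exists (free_bipart D d v); first exact: free_bipart_bihomog.
have /= <- := @bipart_graded _ _ D e 0 (raddfD e) _ d v.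
  by rewrite subr0 (bipart_homog _ hv) eqxx.
by move=> d' v' /e_gr; rewrite subr0.
Qed.

Lemma homog_lift_free (phi : {linear 'rV[S k]_n -> 'rV[S k]_p}) d v :
  graded_map D E phi -> free_bihomog E d (phi v) ->
  exists2 v', free_bihomog D d v' & phi v' = phi v.
Proof.
move=> phi_gr hv; exists (free_bipart D d v); first exact: free_bipart_bihomog.
apply/rowP => i.
have /= <- := @bipart_graded _ _ D (fun v => phi v 0 i) (tnth E i) _ _ d v.
- by rewrite (bipart_homog _ (hv i)) eqxx.
- by move=> u w; rewrite linearD mxE.
- by move=> d' v' hv'; apply: phi_gr.
Qed.

End HomogeneousLifts.

(** * The mapping cone *)

(** The maps of the mapping cone.  The comparison map from the Koszul complex of
    (A, B) sends the generators in homological degree 1 to [a1] and [a2] and the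
    generator in degree 2 to [g]. *)
Section ConeMaps.
Variables (k : closedFieldType) (n2 n1 n0 : nat).
Variables (e : {linear 'rV[S k]_n0 -> (S k)^o})
  (d1 : {linear 'rV[S k]_n1 -> 'rV[S k]_n0}) (d2 : {linear 'rV[S k]_n2 -> 'rV[S k]_n1}).
Variables (F A B : S k) (a1 a2 : 'rV[S k]_n0) (g : 'rV[S k]_n1).

Definition cone_aug (v : 'rV[S k]_(n0 + 1)) : (S k)^o :=
  (e (lsubmx v) : S k) + rsubmx v 0 0 * F.

Definition cone_d1 (w : 'rV[S k]_(n1 + 1 + 1)) : 'rV[S k]_(n0 + 1) :=
  let s := rsubmx (lsubmx w) 0 0 in let t := rsubmx w 0 0 in
  row_mx (d1 (lsubmx (lsubmx w)) - s *: a1 - t *: a2) (s * A + t * B)%:M.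

Definition cone_d2 (z : 'rV[S k]_(n2 + 1)) : 'rV[S k]_(n1 + 1 + 1) :=
  let r := rsubmx z 0 0 in
  row_mx (row_mx (d2 (lsubmx z) + r *: g) (r * B)%:M) (- (r * A))%:M.

Fact cone_aug_linear : linear cone_aug.
Proof.
move=> c v w; rewrite /cone_aug !linearP /= !mxE mulrDl scalerDr.
by rewrite addrACA /GRing.scale /= !mulrA.
Qed.

Fact cone_d1_linear : linear cone_d1.
Proof.
move=> c v w; rewrite /cone_d1 scale_row_mx add_row_mx !linearP /= !mxE.
congr (row_mx _ _); apply/rowP => i; rewrite !mxE; first by ring.
by rewrite (ord1 i) !mulr1n; ring.
Qed.

Fact cone_d2_linear : linear cone_d2.
Proof.
move=> c v w; rewrite /cone_d2 !scale_row_mx !add_row_mx !linearP /= !mxE.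
congr (row_mx (row_mx _ _) _); apply/rowP => i; rewrite !mxE; first by ring.
all: by rewrite (ord1 i) !mulr1n; ring.
Qed.

HB.instance Definition _ := GRing.isLinear.Build _ _ _ _ cone_aug cone_aug_linear.
HB.instance Definition _ := GRing.isLinear.Build _ _ _ _ cone_d1 cone_d1_linear.
HB.instance Definition _ := GRing.isLinear.Build _ _ _ _ cone_d2 cone_d2_linear.

End ConeMaps.

Section Rows.
Variable k : closedFieldType.

Lemma row_mx1_surj n (v : 'rV[S k]_(n + 1)) :
  exists x s, v = row_mx x s%:M.
Proof. by exists (lsubmx v), (rsubmx v 0 0); rewrite -mx11_scalar hsubmxK. Qed.

Lemma eq_row_mx1 n (x y : 'rV[S k]_n) (s t : S k) :
  row_mx x s%:M = row_mx y t%:M -> x = y /\ s = t.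
Proof.
by case/eq_row_mx=> -> /matrixP/(_ 0 0); rewrite !mxE !mulr1n.
Qed.

Lemma row_mx1_0 n : row_mx 0 0%:M = 0 :> 'rV[S k]_(n + 1).
Proof. by rewrite raddf0 row_mx0. Qed.

Lemma free_bihomog_sum1 n (D : n.-tuple (int * int)) d0 d x s :
  free_bihomog (free_sum D [tuple d0]) d (row_mx x s%:M) <->
  free_bihomog D d x /\ bihomog (d - d0) (s : S k).
Proof.
split=> [h|[hx hs] i].
  split=> [i|]; first by have := h (lshift 1 i); rewrite row_mxEl tnth_lshift.
  by have := h (rshift n 0); rewrite row_mxEr tnth_rshift mxE mulr1n.
case: (split_ordP i) => j ->; first by rewrite row_mxEl tnth_lshift.
by rewrite row_mxEr tnth_rshift (ord1 j) mxE mulr1n.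
Qed.

Lemma irrelevant_sum1 n (x : 'rV[S k]_n) (s : S k) :
  (forall i, irrelevant (x 0 i)) -> irrelevant s ->
  forall i, irrelevant ((row_mx x s%:M : 'rV_(n + 1)) 0 i).
Proof.
move=> hx hs i; case: (split_ordP i) => j ->; first by rewrite row_mxEl.
by rewrite row_mxEr (ord1 j) mxE mulr1n.
Qed.

End Rows.

Section Cone.
Variables (k : closedFieldType) (n2 n1 n0 : nat).
Variables (F2 : n2.-tuple (int * int)) (F1 : n1.-tuple (int * int))
  (F0 : n0.-tuple (int * int)) (I : S k -> Prop).
Variables (e : {linear 'rV[S k]_n0 -> (S k)^o})
  (d1 : {linear 'rV[S k]_n1 -> 'rV[S k]_n0}) (d2 : {linear 'rV[S k]_n2 -> 'rV[S k]_n1}).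

Lemma cone_augE (F : S k) (x : 'rV_n0) (s : S k) :
  cone_aug e F (row_mx x s%:M) = (e x : S k) + s * F.
Proof. by rewrite /cone_aug row_mxKl row_mxKr mxE mulr1n. Qed.

Lemma cone_d1E (A B : S k) a1 a2 (x : 'rV_n1) (s t : S k) :
  cone_d1 d1 A B a1 a2 (row_mx (row_mx x s%:M) t%:M) =
  row_mx (d1 x - s *: a1 - t *: a2) (s * A + t * B)%:M.
Proof. by rewrite /cone_d1 !row_mxKl !row_mxKr !mxE !mulr1n. Qed.

Lemma cone_d2E (A B : S k) g (x : 'rV_n2) (r : S k) :
  cone_d2 d2 A B g (row_mx x r%:M) =
  row_mx (row_mx (d2 x + r *: g) (r * B)%:M) (- (r * A))%:M.
Proof. by rewrite /cone_d2 !row_mxKl !row_mxKr !mxE !mulr1n. Qed.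

Hypotheses
  (e_gr : forall d v, free_bihomog F0 d v -> bihomog d (e v : S k))
  (d1_gr : graded_map F1 F0 d1) (d2_gr : graded_map F2 F1 d2)
  (e_im : forall f, I f <-> exists v, e v = f)
  (e_ker : forall v, e v = 0 <-> exists w, d1 w = v)
  (d1_ker : forall w, d1 w = 0 <-> exists z, d2 z = w)
  (d2_inj : injective d2) (d1_min : minimal_map d1) (d2_min : minimal_map d2).

(** Exactness uses the colon ideal at the generators, and the Koszul syzygies of
    (A, B) one step further; minimality holds because the comparison map is
    irrelevant entry by entry. *)
Theorem mapping_cone (dF dA dB : int * int) (F A B : S k) a1 a2 g :
  bihomog dF F -> bihomog dA A -> bihomog dB B ->
  irrelevant A -> irrelevant B -> B != 0 ->
  free_bihomog F0 (dF + dA) a1 -> (forall i, irrelevant (a1 0 i)) -> e a1 = A * F ->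
  free_bihomog F0 (dF + dB) a2 -> (forall i, irrelevant (a2 0 i)) -> e a2 = B * F ->
  free_bihomog F1 (dF + dA + dB) g -> (forall i, irrelevant (g 0 i)) ->
  d1 g = B *: a1 - A *: a2 ->
  (forall x, I (x * F) -> exists s t, x = s * A + t * B) ->
  (forall s t, s * A + t * B = 0 -> exists r, s = r * B /\ t = - (r * A)) ->
  minimal_free_resolution
    (free_sum F2 [tuple dF + dA + dB])
    (free_sum (free_sum F1 [tuple dF + dA]) [tuple dF + dB])
    (free_sum F0 [tuple dF]) (ideal_ext I F).
Proof.
move=> hF hA hB mA mB nzB a1_gr a1_min ea1 a2_gr a2_min ea2 g_gr g_min d1g colon syz.
have eZ s x : e (s *: x) = s * (e x : S k) :> S k by rewrite linearZ.
exists (cone_aug e F), (cone_d1 d1 A B a1 a2), (cone_d2 d2 A B g); split; last first.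
- split=> v i.
  + have [w [t ->]] := row_mx1_surj v; have [x [s ->]] := row_mx1_surj w.
    rewrite [X in irrelevant (fun_of_matrix X _ _)]cone_d1E.
    apply: irrelevant_sum1; last first.
      by apply: irrelevantD; apply: irrelevantM.
    by move=> {}i; rewrite !mxE; apply: irrelevantD; [apply: irrelevantD; [exact: d1_min|]|];
      apply: irrelevantN; apply: irrelevantM.
  + have [x [r ->]] := row_mx1_surj v.
    rewrite [X in irrelevant (fun_of_matrix X _ _)]cone_d2E.
    apply: irrelevant_sum1; last by apply/irrelevantN/irrelevantM.
    apply: irrelevant_sum1; last exact: irrelevantM.
    by move=> {}i; rewrite !mxE; apply: irrelevantD; [exact: d2_min | exact: irrelevantM].
- split.
  + move=> f; split=> [|[v <-]].
    * apply: (ideal_gen_min (I := fun h => exists v, cone_aug e F v = h))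
        => [|h [/e_im[v <-]|->]].
      - split; first by exists 0; rewrite linear0.
          by move=> _ _ [v <-] [w <-]; exists (v + w); rewrite linearD.
        by move=> c _ [v <-]; exists (c *: v); rewrite linearZ.
      - by exists (row_mx v 0%:M); rewrite [LHS]cone_augE mul0r addr0.
      - by exists (row_mx 0 1%:M); rewrite [LHS]cone_augE linear0 add0r mul1r.
    * have [x [s ->]] := row_mx1_surj v; rewrite [X in ideal_ext _ _ X]cone_augE.
      have [_ extD extM] := ideal_ext_is_ideal I F.
      apply: (extD); last exact/extM/mem_ideal_ext.
      by apply/sub_ideal_ext/e_im; exists x.
  + move=> v; split=> [|[w <-]].
    * have [x [s ->]] := row_mx1_surj v; rewrite [LHS]cone_augE => exs.
      (* a relation e x + s F = 0 puts s in I : F *)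
      have /colon[s' [t' es]] : I (s * F).
        apply/e_im; exists (- x); rewrite linearN /=.
        by apply/eqP; rewrite eq_sym -addr_eq0 addrC exs.
      have /e_ker[w ew] : e (x + s' *: a1 + t' *: a2) = 0.
        rewrite !linearD /= !eZ ea1 ea2 -exs es -addrA; congr (_ + _).
        by rewrite mulrDl !mulrA.
      exists (row_mx (row_mx w s'%:M) t'%:M); rewrite [LHS]cone_d1E ew es.
      by congr (row_mx _ _); rewrite addrAC addrK addrK.
    * have [y [t ->]] := row_mx1_surj w; have [x [s ->]] := row_mx1_surj y.
      change (cone_aug e F (cone_d1 d1 A B a1 a2 (row_mx (row_mx x s%:M) t%:M)) = 0).
      rewrite cone_d1E cone_augE !linearB /= !eZ ea1 ea2.
      have -> : e (d1 x) = 0 by apply/e_ker; exists x.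
      by rewrite sub0r mulrDl !mulrA addrACA !addNr addr0.
  + move=> w; split=> [|[z <-]].
    * have [y [t ->]] := row_mx1_surj w; have [x [s ->]] := row_mx1_surj y.
      rewrite [LHS]cone_d1E -row_mx1_0 => /eq_row_mx1[ex /syz[r [es et]]].
      (* (s, t) is r times the Koszul syzygy (B, -A), which [g] lifts *)
      have /d1_ker[z ez] : d1 (x - r *: g) = 0.
        rewrite linearB linearZ /= d1g -ex es et scaleNr.
        by apply/rowP=> i; rewrite !mxE; ring.
      by exists (row_mx z r%:M); rewrite [LHS]cone_d2E ez subrK -es -et.
    * have [x [r ->]] := row_mx1_surj z.
      change (cone_d1 d1 A B a1 a2 (cone_d2 d2 A B g (row_mx x r%:M)) = 0).
      rewrite cone_d2E cone_d1E linearD linearZ /= d1g.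
      have -> : d1 (d2 x) = 0 by apply/d1_ker; exists x.
      rewrite -row_mx1_0; congr (row_mx _ _%:M); last by ring.
      by apply/rowP=> i; rewrite !mxE; ring.
  + apply: raddf_inj => z; have [x [r ->]] := row_mx1_surj z.
    rewrite [LHS]cone_d2E -row_mx1_0 => /eq_row_mx1[+ _].
    rewrite -row_mx1_0 => /eq_row_mx1[+ /eqP].
    rewrite mulf_eq0 (negPf nzB) orbF => + /eqP r0; rewrite r0 scale0r addr0.
    by rewrite -(linear0 d2) => /d2_inj ->; rewrite row_mx1_0.
- split.
  + move=> d v; have [x [s ->]] := row_mx1_surj v => /free_bihomog_sum1[hx hs].
    rewrite [X in bihomog _ X]cone_augE; apply: bihomogD; first exact: e_gr.
    by rewrite -[d](subrK dF); apply: bihomogM.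
  + move=> d v; have [y [t ->]] := row_mx1_surj v; have [x [s ->]] := row_mx1_surj y.
    move=> /free_bihomog_sum1[/free_bihomog_sum1[hx hs] ht].
    rewrite [X in free_bihomog _ _ X]cone_d1E; apply/free_bihomog_sum1; split.
      do 2?[apply: free_bihomogD]; first exact: d1_gr.
        apply: free_bihomogN; rewrite -[d](subrK (dF + dA)); exact: free_bihomogZ.
      apply: free_bihomogN; rewrite -[d](subrK (dF + dB)); exact: free_bihomogZ.
    apply: bihomogD.
      rewrite (_ : d - dF = d - (dF + dA) + dA); first exact: bihomogM.
      by rewrite opprD addrA subrK.
    rewrite (_ : d - dF = d - (dF + dB) + dB); first exact: bihomogM.
    by rewrite opprD addrA subrK.
  + move=> d v; have [x [r ->]] := row_mx1_surj v => /free_bihomog_sum1[hx hr].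
    rewrite [X in free_bihomog _ _ X]cone_d2E.
    apply/free_bihomog_sum1; split; first apply/free_bihomog_sum1; first split.
    * apply: free_bihomogD; first exact: d2_gr.
      rewrite -[d](subrK (dF + dA + dB)); exact: free_bihomogZ.
    * rewrite (_ : _ - _ = d - (dF + dA + dB) + dB); first exact: bihomogM.
      by rewrite [- (_ + dB)]opprD addrA subrK.
    * apply: bihomogN.
      rewrite (_ : _ - _ = d - (dF + dA + dB) + dA); first exact: bihomogM.
      by rewrite [_ + dA + dB]addrAC [- (_ + dA)]opprD addrA subrK.
Qed.

End Cone.

Section CornerCone.
Variables (k : closedFieldType) (n2 n1 n0 : nat).
Variables (F2 : n2.-tuple (int * int)) (F1 : n1.-tuple (int * int))
  (F0 : n0.-tuple (int * int)) (I : S k -> Prop).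

(** Adding F = (p f)(q g) when p f A q, p q g B and p A q B lie in I.  The third
    form is what makes the lift of the Koszul syzygy irrelevant: it splits that
    syzygy as g times one syzygy plus f times another. *)
Theorem resolution_add_corner (p f A q g B : S k) (dp df dA dq dg dB : nat) :
  bihomog (bd dp 0) p -> bihomog (bd df 0) f -> bihomog (bd dA 0) A ->
  bihomog (bd 0 dq) q -> bihomog (bd 0 dg) g -> bihomog (bd 0 dB) B ->
  irrelevant f -> irrelevant A -> irrelevant g -> irrelevant B -> B != 0 ->
  I (p * f * A * q) -> I (p * (q * g * B)) -> I (p * A * (q * B)) ->
  (forall x, I (x * (p * f * (q * g))) -> exists s t, x = s * A + t * B) ->
  (forall s t, s * A + t * B = 0 -> exists r, s = r * B /\ t = - (r * A)) ->
  let u := (dp + df)%N in let v := (dq + dg)%N in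
  minimal_free_resolution F2 F1 F0 I ->
  minimal_free_resolution
    (free_sum F2 (twist (u + dA) (v + dB)))
    (free_sum (free_sum F1 (twist (u + dA) v)) (twist u (v + dB)))
    (free_sum F0 (twist u v)) (ideal_ext I (p * f * (q * g))).
Proof.
move=> hp hf hA hq hg hB mf mA mg mB nzB I1 I2 I3 colon syz u v.
case=> [e [d1 [d2 [[e_gr d1_gr d2_gr] [e_im e_ker d1_ker d2_inj] [d1_min d2_min]]]]].
have hF : bihomog (bd u v) (p * f * (q * g)).
  have -> : bd u v = bd dp 0 + bd df 0 + (bd 0 dq + bd 0 dg) by rewrite !bdD !addn0.
  by apply: bihomogM; apply: bihomogM.
have hI1 : bihomog (bd (u + dA) dq) (p * f * A * q).
  have -> : bd (u + dA) dq = bd dp 0 + bd df 0 + bd dA 0 + bd 0 dq.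
    by rewrite !bdD !addn0.
  by do 3?[apply: bihomogM].
have hI2 : bihomog (bd dp (v + dB)) (p * (q * g * B)).
  have -> : bd dp (v + dB) = bd dp 0 + (bd 0 dq + bd 0 dg + bd 0 dB).
    by rewrite !bdD !addn0.
  by do 3?[apply: bihomogM].
have hI3 : bihomog (bd (dp + dA) (dq + dB)) (p * A * (q * B)).
  have -> : bd (dp + dA) (dq + dB) = bd dp 0 + bd dA 0 + (bd 0 dq + bd 0 dB).
    by rewrite !bdD !addn0.
  by apply: bihomogM; apply: bihomogM.
have eZ s x : e (s *: x) = s * (e x : S k) :> S k by rewrite linearZ.
have lift h d : I h -> bihomog d h -> exists2 w, free_bihomog F0 d w & e w = h.
  move=> /e_im[w <-] hw; have [w' hw' ew'] := homog_lift_ideal e_gr hw.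
  by exists w'.
have syzygy w d : free_bihomog F0 d w -> e w = 0 ->
    exists2 z, free_bihomog F1 d z & d1 z = w.
  move=> hw /e_ker[z ez]; have hz : free_bihomog F0 d (d1 z) by rewrite ez.
  by have [z' hz' ez'] := homog_lift_free d1_gr hz; exists z'; rewrite // ez'.
have [h1 h1_gr eh1] := lift _ _ I1 hI1.
have [h2 h2_gr eh2] := lift _ _ I2 hI2.
have [h3 h3_gr eh3] := lift _ _ I3 hI3.
have gr d1' d2' d' (x : S k) (w : 'rV_n0) : d1' + d2' = d' ->
    bihomog d1' x -> free_bihomog F0 d2' w -> free_bihomog F0 d' (x *: w).
  by move=> <-; apply: free_bihomogZ.
have gr1 d1' d2' d' (x : S k) (w : 'rV_n1) : d1' + d2' = d' ->
    bihomog d1' x -> free_bihomog F1 d2' w -> free_bihomog F1 d' (x *: w).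
  by move=> <-; apply: free_bihomogZ.
have [w1 w1_gr ew1] : exists2 z, free_bihomog F1 (bd (u + dA) (dq + dB)) z &
    d1 z = B *: h1 - f *: h3.
  apply: syzygy; last by rewrite linearB /= !eZ eh1 eh3; ring.
  apply: free_bihomogD; first by apply: gr hB h1_gr; rewrite bdD; congr bd; lia.
  by apply: free_bihomogN; apply: gr hf h3_gr; rewrite bdD; congr bd; lia.
have [w2 w2_gr ew2] : exists2 z, free_bihomog F1 (bd (dp + dA) (v + dB)) z &
    d1 z = g *: h3 - A *: h2.
  apply: syzygy; last by rewrite linearB /= !eZ eh2 eh3; ring.
  apply: free_bihomogD; first by apply: gr hg h3_gr; rewrite bdD; congr bd; lia.
  by apply: free_bihomogN; apply: gr hA h2_gr; rewrite bdD; congr bd; lia.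
have := @mapping_cone k n2 n1 n0 F2 F1 F0 I e d1 d2 e_gr d1_gr d2_gr e_im e_ker
  d1_ker d2_inj d1_min d2_min (bd u v) (bd dA 0) (bd 0 dB) (p * f * (q * g)) A B
  (g *: h1) (f *: h2) (g *: w1 + f *: w2).
rewrite !bdD !addn0; apply=> //.
- by apply: gr hg h1_gr; rewrite bdD; congr bd; lia.
- by move=> i; rewrite mxE mulrC; apply: irrelevantM.
- by rewrite eZ eh1; ring.
- by apply: gr hf h2_gr; rewrite bdD; congr bd; lia.
- by move=> i; rewrite mxE mulrC; apply: irrelevantM.
- by rewrite eZ eh2; ring.
- apply: free_bihomogD; first by apply: gr1 hg w1_gr; rewrite bdD; congr bd; lia.
  by apply: gr1 hf w2_gr; rewrite bdD; congr bd; lia.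
- by move=> i; rewrite !mxE; apply: irrelevantD; rewrite mulrC; apply: irrelevantM.
- rewrite linearD !linearZ /= ew1 ew2.
  by apply/rowP => i; rewrite !mxE; ring.
Qed.

End CornerCone.

(** * Points and lines *)

Section Points.
Variable k : closedFieldType.
Implicit Types (f g : S k) (R Q : P1 k) (P : P1 k * P1 k).

(** Modulo the ideal of a line or of a point the variables are congruent to a
    parametrization of it, which therefore computes the whole quotient.  Hence these
    ideals are the kernels of substitutions, and prime. *)
Lemma subst_congr (J : S k -> Prop) (sigma : (2 + 2).-tuple (S k)) :
  is_ideal J -> (forall i, J ('X_i - tnth sigma i)) ->
  forall f, J (f - (f \mPo sigma)).
Proof.
move=> [J0 JD JM] JX.
have JD' f g : J (f - (f \mPo sigma)) -> J (g - (g \mPo sigma)) ->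
    J (f + g - ((f + g) \mPo sigma)).
  by rewrite raddfD opprD addrACA; apply: JD.
have JM' f g : J (f - (f \mPo sigma)) -> J (g - (g \mPo sigma)) ->
    J (f * g - ((f * g) \mPo sigma)).
  move=> hf hg; rewrite rmorphM /=.
  have -> : f * g - (f \mPo sigma) * (g \mPo sigma) =
    f * (g - (g \mPo sigma)) + (g \mPo sigma) * (f - (f \mPo sigma)) by ring.
  by apply: JD; apply: JM.
elim/mpolyind=> [|c m f _ _ Jf]; first by rewrite raddf0 subrr.
apply: JD' => //; rewrite -mul_mpolyC; apply: (JM').
  by rewrite comp_mpolyC subrr.
rewrite mpolyXE_id; elim/big_ind: _ => [||i _]; first by rewrite rmorph1 subrr.
  exact: JM'.
elim: (m i) => [|n IHn]; first by rewrite expr0 rmorph1 subrr.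
by rewrite exprS; apply: JM' => //; rewrite comp_mpolyXU -tnth_nth.
Qed.

Lemma bihomog_LX R : bihomog (bd 1 0) (LX R).
Proof.
have hx i : bihomog (bd 1 0) (x_ k i).
  move=> m; rewrite msuppX mem_seq1 => /eqP ->.
  rewrite /bideg !big_ord_recl !big_ord0 !mnm1E.
  by case: i => [[|[|//]]].
by apply: bihomogD; [|apply: bihomogN]; apply: bihomogZ.
Qed.

Lemma bihomog_LY Q : bihomog (bd 0 1) (LY Q).
Proof.
have hy i : bihomog (bd 0 1) (y_ k i).
  move=> m; rewrite msuppX mem_seq1 => /eqP ->.
  rewrite /bideg !big_ord_recl !big_ord0 !mnm1E.
  by case: i => [[|[|//]]].
by apply: bihomogD; [|apply: bihomogN]; apply: bihomogZ.
Qed.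

Lemma irrelevant_var (i : 'I_(2 + 2)) : irrelevant ('X_i : S k).
Proof. by apply: mem_ideal_gen; exists i. Qed.

Lemma irrelevant_LX R : irrelevant (LX R).
Proof.
by rewrite /LX -!mul_mpolyC; apply: irrelevantD; [|apply: irrelevantN];
  apply/irrelevantM/irrelevant_var.
Qed.

Lemma irrelevant_LY Q : irrelevant (LY Q).
Proof.
by rewrite /LY -!mul_mpolyC; apply: irrelevantD; [|apply: irrelevantN];
  apply/irrelevantM/irrelevant_var.
Qed.

(** Proportional points are equal because representatives are normalized. *)
Lemma P1_eq R R' : (val R').2 * (val R).1 = (val R').1 * (val R).2 -> R' = R.
Proof.
case: R R' => [[a b] /= h] [[a' b'] /= h'] e; apply/val_inj; move: h h' e => /=.
case/orP=> [/eqP->|/andP[/eqP-> /eqP->]] /orP[/eqP->|/andP[/eqP-> /eqP->]] //.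
- by rewrite mulr1 mul1r => ->.
- by rewrite mulr1 mul0r => /eqP; rewrite oner_eq0.
- by rewrite mulr0 mulr1 => /esym/eqP; rewrite oner_eq0.
Qed.

(** A coordinate that does not vanish at [R], through which both coordinates are
    expressed on the line of [R]. *)
Definition xpivot R : S k := if (val R).1 == 1 then x_ k 0 else x_ k 1.
Definition ypivot Q : S k := if (val Q).1 == 1 then y_ k 0 else y_ k 1.

Definition subst4 (a0 a1 b0 b1 : S k) : (2 + 2).-tuple (S k) := [tuple a0; a1; b0; b1].

Lemma subst4_LX a0 a1 b0 b1 R :
  LX R \mPo subst4 a0 a1 b0 b1 = (val R).2 *: a0 - (val R).1 *: a1.
Proof. by rewrite /LX raddfB /= !comp_mpolyZ !comp_mpolyXU. Qed.

Lemma subst4_LY a0 a1 b0 b1 Q :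
  LY Q \mPo subst4 a0 a1 b0 b1 = (val Q).2 *: b0 - (val Q).1 *: b1.
Proof. by rewrite /LY raddfB /= !comp_mpolyZ !comp_mpolyXU. Qed.

Lemma pivot_congr (X0 X1 : S k) (J : S k -> Prop) R : is_ideal J ->
  J ((val R).2 *: X0 - (val R).1 *: X1) ->
  let s := if (val R).1 == 1 then X0 else X1 in
  J (X0 - (val R).1 *: s) /\ J (X1 - (val R).2 *: s).
Proof.
case: R => [[a b] /= h] [J0 _ JM] JL; move: h JL.
case: ifP => [/eqP -> _|_ /= /andP[/eqP -> /eqP ->]]; rewrite !scale1r.
  by move=> h; rewrite subrr; split=> //; rewrite -opprB -mulN1r; apply: JM.
by rewrite scale0r !subr0 subrr.
Qed.

Definition line_subst R :=
  subst4 ((val R).1 *: xpivot R) ((val R).2 *: xpivot R) (y_ k 0) (y_ k 1).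

Definition point_subst P :=
  subst4 ((val P.1).1 *: xpivot P.1) ((val P.1).2 *: xpivot P.1)
    ((val P.2).1 *: ypivot P.2) ((val P.2).2 *: ypivot P.2).

Lemma X_neq0 (i : 'I_(2 + 2)) : 'X_i != 0 :> S k.
Proof.
apply/eqP => /(congr1 (fun f => f@_U_(i))).
by rewrite mcoeffX eqxx mcoeff0 => /eqP; rewrite oner_eq0.
Qed.

Lemma LX_pivot_eq0 R R' (X : S k) : X != 0 ->
  (val R').2 *: ((val R).1 *: X) - (val R').1 *: ((val R).2 *: X) = 0 -> R' = R.
Proof.
move=> nzX; rewrite !scalerA -scalerBl => /eqP; rewrite scaler_eq0 (negPf nzX) orbF subr_eq0.
by move=> /eqP /P1_eq.
Qed.

Lemma line_divP R f : (f \mPo line_subst R) = 0 -> exists g, f = g * LX R.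
Proof.
move=> f0; pose J h := exists g, h = g * LX R.
have idJ : is_ideal J.
  split; first by exists 0; rewrite mul0r.
    by move=> _ _ [a ->] [b ->]; exists (a + b); rewrite mulrDl.
  by move=> c _ [a ->]; exists (c * a); rewrite mulrA.
have [J0 J1] : J (x_ k 0 - (val R).1 *: xpivot R) /\ J (x_ k 1 - (val R).2 *: xpivot R).
  by apply: pivot_congr => //; exists 1; rewrite mul1r.
have [Jz _ _] := idJ.
rewrite -[f]subr0 -f0; apply: (subst_congr idJ) => i.
rewrite (tnth_nth 0).
case: i => [[|[|[|[|//]]]] hi] /=.
- by rewrite (_ : Ordinal hi = lshift 2 0) //; apply: val_inj.
- by rewrite (_ : Ordinal hi = lshift 2 1) //; apply: val_inj.
- by rewrite (_ : Ordinal hi = rshift 2 0) ?subrr //; apply: val_inj.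
- by rewrite (_ : Ordinal hi = rshift 2 1) ?subrr //; apply: val_inj.
Qed.

Lemma point_ideal_is_ideal P : is_ideal (point_ideal P).
Proof. exact: ideal_gen_is_ideal. Qed.

Lemma point_idealE P f :
  point_ideal P f <-> exists s t, f = s * LX P.1 + t * LY P.2.
Proof.
have [_ PD PM] := point_ideal_is_ideal P.
split=> [|[s [t ->]]]; last first.
  by apply: PD; apply: PM; apply: mem_ideal_gen; [left|right].
apply: (ideal_gen_min (I := fun f => exists s t, f = s * LX P.1 + t * LY P.2)).
  split; first by exists 0, 0; rewrite !mul0r addr0.
    move=> _ _ [s [t ->]] [s' [t' ->]]; exists (s + s'), (t + t').
    by rewrite !mulrDl addrACA.
  by move=> c _ [s [t ->]]; exists (c * s), (c * t); rewrite mulrDr !mulrA.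
move=> g [->|->]; first by exists 1, 0; rewrite mul1r mul0r addr0.
by exists 0, 1; rewrite mul1r mul0r add0r.
Qed.

Lemma point_idealP P f : point_ideal P f <-> (f \mPo point_subst P) = 0.
Proof.
split=> [/point_idealE[s [t ->]]|f0].
  rewrite rmorphD !rmorphM /= /point_subst subst4_LX subst4_LY !scalerA.
  by rewrite ![_.1 * _]mulrC !subrr !mulr0 addr0.
have idP := point_ideal_is_ideal P.
have [J0 J1] : point_ideal P (x_ k 0 - (val P.1).1 *: xpivot P.1) /\
    point_ideal P (x_ k 1 - (val P.1).2 *: xpivot P.1).
  by apply: pivot_congr => //; apply: mem_ideal_gen; left.
have [J2 J3] : point_ideal P (y_ k 0 - (val P.2).1 *: ypivot P.2) /\
    point_ideal P (y_ k 1 - (val P.2).2 *: ypivot P.2).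
  by apply: pivot_congr => //; apply: mem_ideal_gen; right.
rewrite -[f]subr0 -f0; apply: (subst_congr idP) => i.
rewrite (tnth_nth 0).
case: i => [[|[|[|[|//]]]] hi] /=.
- by rewrite (_ : Ordinal hi = lshift 2 0) //; apply: val_inj.
- by rewrite (_ : Ordinal hi = lshift 2 1) //; apply: val_inj.
- by rewrite (_ : Ordinal hi = rshift 2 0) //; apply: val_inj.
- by rewrite (_ : Ordinal hi = rshift 2 1) //; apply: val_inj.
Qed.

Lemma xpivot_neq0 R : xpivot R != 0.
Proof. by rewrite /xpivot; case: ifP => _; apply: X_neq0. Qed.

Lemma ypivot_neq0 Q : ypivot Q != 0.
Proof. by rewrite /ypivot; case: ifP => _; apply: X_neq0. Qed.

Lemma point_ideal_LX P R : point_ideal P (LX R) <-> R = P.1.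
Proof.
split=> [/point_idealP|->]; last by apply: mem_ideal_gen; left.
by rewrite subst4_LX; apply: LX_pivot_eq0; apply: xpivot_neq0.
Qed.

Lemma point_ideal_LY P Q : point_ideal P (LY Q) <-> Q = P.2.
Proof.
split=> [/point_idealP|->]; last by apply: mem_ideal_gen; right.
by rewrite subst4_LY; apply: LX_pivot_eq0; apply: ypivot_neq0.
Qed.

Lemma point_idealM P f g : point_ideal P (f * g) -> point_ideal P f \/ point_ideal P g.
Proof.
move=> /point_idealP; rewrite rmorphM /= => /eqP; rewrite mulf_eq0.
by case/orP=> /eqP h; [left|right]; apply/point_idealP.
Qed.

Lemma point_ideal1 P : ~ point_ideal P 1.
Proof. by move/point_idealP; rewrite rmorph1 => /eqP; rewrite oner_eq0. Qed.

Lemma exists_other_point R : exists R', R' <> R.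
Proof.
pose R0 : P1 k := exist _ (1, 0) (introT orP (or_introl (eqxx _))).
pose R1 : P1 k := exist _ (0, 1)
  (introT orP (or_intror (introT andP (conj (eqxx _) (eqxx _))))).
have neR : R1 <> R0.
  by move=> /(congr1 (fun R => (val R).1)) /= /esym/eqP; rewrite oner_eq0.
by have [<-|/eqP] := eqVneq R0 R; [exists R1 | exists R0].
Qed.

Lemma LX_neq0 R : LX R != 0.
Proof.
have [R' neR] := exists_other_point R; apply/eqP => L0.
have /point_ideal_LX /esym // : point_ideal (R', R') (LX R).
by apply/point_idealP; rewrite L0 raddf0.
Qed.

Lemma LY_neq0 Q : LY Q != 0.
Proof.
have [Q' neQ] := exists_other_point Q; apply/eqP => L0.
have /point_ideal_LY /esym // : point_ideal (Q', Q') (LY Q).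
by apply/point_idealP; rewrite L0 raddf0.
Qed.

Lemma prod_LY_line_subst (qs : seq (P1 k)) R :
  (\prod_(Q <- qs) LY Q) \mPo line_subst R = \prod_(Q <- qs) LY Q.
Proof. by rewrite rmorph_prod; apply: eq_bigr => Q _; rewrite /= subst4_LY. Qed.

Lemma prod_LY_neq0 (qs : seq (P1 k)) : \prod_(Q <- qs) LY Q != 0.
Proof. by elim/big_rec: _ => [|Q p _ p0]; rewrite ?oner_neq0 // mulf_neq0 ?LY_neq0. Qed.

(** A form in the x's and a form in the y's have no common line: substituting for
    the x's the parametrization of one line of the first leaves the second alone. *)
Lemma lines_regular (rs qs : seq (P1 k)) (s t : S k) :
  s * (\prod_(R <- rs) LX R) + t * (\prod_(Q <- qs) LY Q) = 0 ->
  exists r, s = r * (\prod_(Q <- qs) LY Q) /\ t = - (r * \prod_(R <- rs) LX R).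
Proof.
set B := \prod_(Q <- qs) LY Q.
elim: rs s t => [|R rs IHrs] s t.
  rewrite big_nil mulr1 => /eqP; rewrite addr_eq0 => /eqP ->.
  by exists (- t); rewrite mulr1 opprK mulNr.
rewrite big_cons => est.
have [t' et] : exists t', t = t' * LX R.
  apply: line_divP; apply/eqP; move/(congr1 (fun f => f \mPo line_subst R)): est.
  rewrite rmorphD !rmorphM raddf0 /= subst4_LX !scalerA [_.1 * _]mulrC subrr mul0r mulr0 add0r.
  by move/eqP; rewrite prod_LY_line_subst mulf_eq0 (negPf (prod_LY_neq0 _)) orbF.
have [r [-> et']] : exists r, s = r * B /\ t' = - (r * \prod_(R <- rs) LX R).
  apply: IHrs; apply: (mulfI (LX_neq0 R)); rewrite mulr0 -est et; ring.
by exists r; split=> //; rewrite et et'; ring.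
Qed.

(** Peel off one point at a time: if [s * LX R + t * LY Q] vanishes at the other
    points of the line of [R], so does [t], the point ideals being prime. *)
Lemma points_on_line (qs : seq (P1 k)) R f : uniq qs ->
  {in qs, forall Q, point_ideal (R, Q) f} ->
  exists s t, f = s * LX R + t * \prod_(Q <- qs) LY Q.
Proof.
elim: qs f => [|Q qs IHqs] f.
  by exists 0, f; rewrite big_nil mul0r add0r mulr1.
case/andP=> Qqs uqs hf.
have /point_idealE[s [t /= ef]] := hf Q (mem_head _ _).
have [] := IHqs t uqs.
  move=> Q' Q'qs; have [_ PD PM] := point_ideal_is_ideal (R, Q').
  have : point_ideal (R, Q') (t * LY Q).
    have -> : t * LY Q = f + (- s) * LX R by rewrite ef; ring.
    apply: PD; first by apply: hf; rewrite inE Q'qs orbT.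
    by apply: PM; apply/point_ideal_LX.
  by case/point_idealM => // /point_ideal_LY /= eQ; rewrite eQ Q'qs in Qqs.
move=> s' [t' et]; exists (s + s' * LY Q), t'.
by rewrite ef et big_cons; ring.
Qed.

(** The ideal of a grid is a complete intersection, by the same peeling, now of
    whole lines. *)
Lemma points_on_grid (rs qs : seq (P1 k)) f : uniq rs -> uniq qs ->
  {in rs & qs, forall R Q, point_ideal (R, Q) f} ->
  exists s t, f = s * (\prod_(R <- rs) LX R) + t * \prod_(Q <- qs) LY Q.
Proof.
move=> urs uqs; elim: rs f urs => [|R rs IHrs] f.
  by exists f, 0; rewrite big_nil mul0r addr0 mulr1.
case/andP=> Rrs urs hf.
have [Q Qqs|s [t ef]] := points_on_line (R := R) (f := f) uqs.
  by apply: hf => //; apply: mem_head.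
have [] := IHrs s urs.
  move=> R' Q R'rs Qqs; have [_ PD PM] := point_ideal_is_ideal (R', Q).
  have : point_ideal (R', Q) (s * LX R).
    have -> : s * LX R = f + (- t) * \prod_(Q <- qs) LY Q by rewrite ef; ring.
    apply: PD; first by apply: hf; rewrite // inE R'rs orbT.
    rewrite (big_rem Q) //= mulrA mulrAC; apply: PM.
    by apply/point_ideal_LY.
  by case/point_idealM => // /point_ideal_LX /= eR; rewrite eR R'rs in Rrs.
move=> s' [t' es]; exists s', (t + t' * LX R).
by rewrite ef es big_cons; ring.
Qed.

End Points.

(** * Corners *)

Section Corners.
Variable lam : seq nat.
Local Open Scope nat_scope.
Hypothesis lam_noninc : forall a b, a <= b -> nth 0 lam b <= nth 0 lam a.

Lemma leq_ncols a : nth 0 lam a <= ncols lam.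
Proof. by rewrite -nth0; apply: lam_noninc. Qed.

(** Continuing the degree matrix by the value 1 outside the grid lets the border
    of the grid be treated like a row or a column of corners. *)
Definition mult a b : nat := if b < nth 0 lam a then 2 else 1.

Lemma degree_mxE a b : degree_mx lam a b = mult a b.
Proof. by rewrite mxE. Qed.

Lemma mult_gt0 a b : 0 < mult a b.
Proof. by rewrite /mult; case: ifP. Qed.

Lemma leq_mult a b a' b' : a <= a' -> b <= b' -> mult a' b' <= mult a b.
Proof. by move=> /lam_noninc; rewrite /mult; do 2!case: ifP; lia. Qed.

Definition corner_row i : bool :=
  [&& 0 < i, i < nrows lam, 0 < nth 0 lam i & nth 0 lam i < nth 0 lam i.-1].

Definition is_corner i j : bool :=
  corner_row i && has (fun k => corner_row k && (j == nth 0 lam k)) (iota 0 i.+1).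

Lemma is_cornerP i j :
  reflect (corner_row i /\ exists k, [/\ k <= i, corner_row k & j = nth 0 lam k])
          (is_corner i j).
Proof.
apply: (iffP andP) => [[ci /hasP[k]]|[ci [k [ki ck ->]]]].
  rewrite mem_iota add0n => ki /andP[ck /eqP ej]; split=> //.
  by exists k; split.
by split=> //; apply/hasP; exists k; rewrite ?mem_iota ?ck ?eqxx.
Qed.

Lemma is_corner_grid i j : is_corner i j -> i < nrows lam /\ j < ncols lam.
Proof.
case/is_cornerP=> [/and4P[_ ? _ _] [k [_ /and4P[_ _ _ dk] ->]]]; split=> //.
exact: leq_trans dk (leq_ncols _).
Qed.

Lemma base_cornersE c :
  (c \in base_corners lam) = corner_row c.1 && (c.2 == nth 0 lam c.1 :> nat).
Proof.
case: c => i j; rewrite inE /= degree_mxE.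
apply/and3P/andP => [[m1 /existsP[i' /andP[/eqP ei m2]] /existsP[j' /andP[/eqP ej m3]]]|].
  move: m1 m2 m3 (ltn_ord i); rewrite !degree_mxE /mult /corner_row -ei -ej /=.
  by do 3!case: ifP => //; lia.
move=> [/and4P[i0 ir l0 ldrop] /eqP ej].
have i'r : i.-1 < nrows lam by lia.
have j'r : j.-1 < ncols lam by have := ltn_ord j; lia.
split; first by rewrite /mult ej ltnn.
  by apply/existsP; exists (Ordinal i'r); rewrite degree_mxE /mult /= prednK // ej ldrop !eqxx.
apply/existsP; exists (Ordinal j'r); rewrite degree_mxE /mult /=.
by apply/andP; split; [|case: ifP]; lia.
Qed.

(** A corner of the second kind takes its row and its column from two base corners;
    letting the two coincide accounts for the base corners themselves. *)
Lemma mem_corners c : (c \in corners lam) = is_corner c.1 c.2.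
Proof.
rewrite mem_sort mem_enum inE base_cornersE.
apply/orP/is_cornerP => [[/andP[c1 /eqP ->]|]|[c1 [k [kc ck ej]]]].
- by split=> //; exists c.1.
- rewrite inE => /existsP[j /existsP[i]]; rewrite !base_cornersE /=.
  by case/and3P=> /andP[c1 _] /andP[ci /eqP ej] lt; split=> //; exists i; split=> //; apply: ltnW.
have [ek|nek] := eqVneq k c.1; first by left; rewrite c1 -ek ej eqxx.
right; rewrite inE.
have lt_j : nth 0 lam c.1 < ncols lam.
  have lek : k <= c.1.-1 by lia.
  have := lam_noninc lek; have := leq_ncols k; case/and4P: c1; lia.
have lt_k : k < nrows lam by case/and4P: ck.
apply/existsP; exists (Ordinal lt_j); apply/existsP; exists (Ordinal lt_k).
by rewrite !base_cornersE /= c1 ck ej !eqxx /= ltn_neqAle nek.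
Qed.

(** This is why the factor g of F is not constant: the column with index
    [nth 0 lam i'] is left of [j], and its entry is 2 in row [i] but 1 in row [i']. *)
Lemma corner_row_drop i j i' : is_corner i j -> i < i' ->
  i' = nrows lam \/ is_corner i' j -> nth 0 lam i' < nth 0 lam i <= j.
Proof.
case/is_cornerP=> [ci [k [ki _ ->]]] ii' hi'; rewrite (lam_noninc ki) andbT.
case: hi' => [->|/is_cornerP[/and4P[_ _ _ ci'] _]].
  by rewrite nth_default //; case/and4P: ci.
by apply: leq_trans ci' _; apply: lam_noninc; lia.
Qed.

(** This is why the factor f of F is not constant: the entry of row [a] is 2 in
    column [j] but 1 in column [j']. *)
Lemma corner_col_drop i j j' : is_corner i j -> j < j' ->
  j' = ncols lam \/ is_corner i j' ->
  exists a, [/\ a < i, j < nth 0 lam a & nth 0 lam a <= j'].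
Proof.
case/is_cornerP=> [ci [k [ki _ ej]]] jj' [ej'|/is_cornerP[_ [k' [k'i _ ej']]]].
  by exists 0; rewrite nth0 -ej' jj'; split=> //; case/and4P: ci.
exists k'; rewrite -ej' jj'; split=> //; rewrite ltnNge; apply/negP => ik'.
by have := lam_noninc (leq_trans ki ik'); lia.
Qed.

Lemma lex_ge_trans : transitive (@lex_ge lam).
Proof.
by move=> [b1 b2] [a1 a2] [c1 c2]; rewrite /lex_ge -!val_eqE /=; lia.
Qed.

Lemma lex_ge_total : total (@lex_ge lam).
Proof. by move=> [a1 a2] [c1 c2]; rewrite /lex_ge -!val_eqE /=; lia. Qed.

Variable l : 'I_(size (corners lam)).

Lemma corner_is_corner : is_corner (corner l).1 (corner l).2.
Proof. by rewrite -mem_corners /corner mem_tnth. Qed.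

Lemma cornerE : corner l = nth (corner l) (corners lam) l.
Proof. by rewrite {1}/corner (tnth_nth (corner l)). Qed.

Lemma mem_take_corners c :
  (c \in take l (corners lam)) =
  is_corner c.1 c.2 && (((corner l).1 < c.1) ||
    (((corner l).1 == c.1 :> nat) && ((corner l).2 < c.2))).
Proof.
have uc : uniq (corners lam) by rewrite sort_uniq enum_uniq.
have sc : sorted (@lex_ge lam) (corners lam) by exact: (sort_sorted lex_ge_total).
have il : index (corner l) (corners lam) = l by rewrite cornerE index_uniq.
have cl : corner l \in corners lam by rewrite mem_corners corner_is_corner.
rewrite -mem_corners; have [cc|cc] /= := boolP (c \in corners lam); last first.
  by apply: contraNF cc => /mem_take.
rewrite in_take //.
apply/idP/idP => h.
  have : lex_ge c (corner l).
    by apply: (sorted_ltn_index lex_ge_trans sc) => //; rewrite il.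
  have : c != corner l by apply: contraTneq h => ->; rewrite il ltnn.
  by case: (c) (corner l) => [c1 c2] [d1 d2]; rewrite /lex_ge xpair_eqE -!val_eqE /=; lia.
rewrite ltnNge; apply/negP => hl.
have : lex_ge (corner l) c \/ corner l = c.
  move: hl; rewrite leq_eqVlt => /orP[/eqP e|lt].
    by right; rewrite -[RHS](nth_index (corner l) cc) -e -cornerE.
  by left; apply: (sorted_ltn_index lex_ge_trans sc) => //; rewrite il.
case: (c) (corner l) h => [c1 c2] [d1 d2]; rewrite /lex_ge -!val_eqE /=.
by move=> h [|[e1 e2]]; [lia | move: h; rewrite e1 e2; lia].
Qed.

Definition cleared a b : bool :=
  has (fun d : 'I_(nrows lam) * 'I_(ncols lam) => (d.1 <= a) && (d.2 <= b))
      (take l (corners lam)).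

Lemma deg_mxE a b :
  deg_mx lam l a b = if cleared a b then 0 else mult a b.
Proof.
rewrite /cleared /deg_mx -degree_mxE; elim: (take _ _) (degree_mx lam) => //= c s IHs M.
by rewrite IHs mxE; case: has; rewrite ?orbT ?orbF.
Qed.

(** What the larger corners leave of the quadrant of the corner (i, j).  A larger
    corner (d1, d2) below row i gives the corner (d1, j), so if it meets the quadrant
    it clears rows from i' on; a larger corner of row i clears columns from j' on. *)
Lemma corner_rectangle :
  let i := (corner l).1 in let j := (corner l).2 in
  exists i' j', [/\ i < i' <= nrows lam, j < j' <= ncols lam,
    i' = nrows lam \/ is_corner i' j, j' = ncols lam \/ is_corner i j' &
    [/\ forall a, deg_mx lam l a j =
          if a < i then mult a j else if a < i' then 1 else 0,
        forall b, deg_mx lam l i b =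
          if b < j then mult i b else if b < j' then 1 else 0 &
        forall (a : 'I_(nrows lam)) (b : 'I_(ncols lam)), a < i' -> b < j' ->
          i <= a -> j <= b -> ~~ cleared a b]].
Proof.
have := corner_is_corner; have := mem_take_corners.
case: (corner l) => [i j] /= processedE /is_cornerP[ci [k [ki ck ej]]].
have li : nth 0 lam i <= j by rewrite ej lam_noninc.
have lower d1 d2 : i < d1 -> is_corner d1 d2 -> is_corner d1 j.
  move=> id /is_cornerP[cd _]; apply/is_cornerP; split=> //.
  by exists k; split=> //; apply: leq_trans ki (ltnW id).
have ex1 : exists n, (i < n) && ((n == nrows lam) || is_corner n j).
  by exists (nrows lam); rewrite ltn_ord eqxx.
have ex2 : exists n, (j < n) && ((n == ncols lam) || is_corner i n).
  by exists (ncols lam); rewrite ltn_ord eqxx.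
case: (ex_minnP ex1) => i' /andP[ii' ci'] min_i'.
case: (ex_minnP ex2) => j' /andP[jj' cj'] min_j'.
have i'r : i' <= nrows lam by apply: min_i'; rewrite ltn_ord eqxx.
have j't : j' <= ncols lam by apply: min_j'; rewrite ltn_ord eqxx.
have proc d : d \in take l (corners lam) -> i' <= d.1 \/ d.1 = i :> nat /\ j' <= d.2.
  rewrite processedE => /andP[cd /orP[lt|/andP[/eqP e lt]]].
    by left; apply: min_i'; rewrite lt (lower d.1 d.2) ?orbT.
  by right; split; [|apply: min_j'; rewrite lt e cd orbT].
exists i', j'; split; rewrite ?ii' ?jj' //.
- by case/orP: ci' => [/eqP|]; [left|right].
- by case/orP: cj' => [/eqP|]; [left|right].
split=> [a|b|a b lai' lbj' ia jb].
- rewrite deg_mxE /cleared; case: hasP => [[[d1 d2] /proc /= hd /andP[/= da dj]]|nh].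
    by case: hd => [hd|[_ hd]]; case: ifP => h1; [|case: ifP => h2| |case: ifP => h2]; lia.
  case: ifP => // ai; have ia : i <= a by rewrite leqNgt ai.
  rewrite ltnNge; case: (boolP (i' <= a)) => [i'a|_] /=; last first.
    by rewrite /mult; case: ifP => //; have := lam_noninc ia; lia.
  have i'r' : i' < nrows lam by apply: (leq_ltn_trans i'a).
  case: nh; exists (Ordinal i'r', j); rewrite /= ?i'a ?leqnn // processedE /=.
  by move: ci'; rewrite (ltn_eqF i'r') /= => ->; rewrite ii'.
- rewrite deg_mxE /cleared; case: hasP => [[[d1 d2] /proc /= hd /andP[/= da dj]]|nh].
    by case: hd => [hd|[_ hd]]; case: ifP => h1; [|case: ifP => h2| |case: ifP => h2]; lia.
  case: ifP => // bj; have jb : j <= b by rewrite leqNgt bj.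
  rewrite ltnNge; case: (boolP (j' <= b)) => [j'b|_] /=; last first.
    by rewrite /mult; case: ifP => //; lia.
  have j't' : j' < ncols lam by apply: (leq_ltn_trans j'b).
  case: nh; exists (i, Ordinal j't'); rewrite /= ?j'b ?leqnn // processedE /=.
  by move: cj'; rewrite (ltn_eqF j't') /= => ->; rewrite jj' eqxx orbT.
- by apply/hasPn => [[d1 d2]] /proc /= [|[_]]; lia.
Qed.

End Corners.

(** * The forms of the corners *)

Section PowerProducts.
Variables (k : closedFieldType) (n : nat) (L : 'I_n -> S k).
Implicit Types (e : nat -> nat) (i : nat).

Definition pprod e i : S k := \prod_(a < n | (a < i)%N) L a ^+ e a.

Lemma pprod_split e e' i : (forall a, e' a <= e a)%N ->
  pprod e i = pprod e' i * pprod (fun a => e a - e' a)%N i.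
Proof.
by move=> le_e; rewrite -big_split /=; apply: eq_bigr => a _; rewrite -exprD subnKC.
Qed.

Lemma pprod_ext e i i' : (i <= i')%N -> (forall a, i <= a < i' -> e a = 1)%N ->
  pprod e i' = pprod e i * \prod_(a < n | (i <= a < i')%N) L a.
Proof.
move=> ii' e1; rewrite /pprod (bigID (fun a : 'I_n => (a < i)%N)) /=.
congr (_ * _); first by apply: eq_bigl => a; lia.
by apply: eq_big => a; [lia | move=> ha; rewrite e1 ?expr1 //; lia].
Qed.

Lemma pprod_ideal (J : S k -> Prop) e i (a : 'I_n) : is_ideal J ->
  J (L a ^+ e a) -> (a < i)%N -> J (pprod e i).
Proof.
by move=> [_ _ JM] Ja ai; rewrite /pprod (bigD1 a) //= mulrC; apply: JM.
Qed.

Lemma bihomog_prod d (P : pred 'I_n) (e : 'I_n -> nat) : (forall a, bihomog d (L a)) ->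
  bihomog (d *+ (\sum_(a | P a) e a)) (\prod_(a | P a) L a ^+ e a).
Proof.
move=> hL.
have h1 : bihomog 0 (1 : S k).
  by move=> m; rewrite msupp1 mem_seq1 => /eqP ->; rewrite /bideg !big1 // => ? _; rewrite mnm0E.
elim/big_rec2: _ => [//|a p s Pa hp].
rewrite mulrnDr; apply: bihomogM => //.
by elim: (e a) => [//|m IHm]; rewrite mulrS exprS; apply: bihomogM.
Qed.

End PowerProducts.

Section Forms.
Variables (k : closedFieldType) (lam : seq nat).
Hypothesis lam_noninc : forall a b, (a <= b)%N -> (nth 0 lam b <= nth 0 lam a)%N.
Variables (R : 'I_(nrows lam) -> P1 k) (Q : 'I_(ncols lam) -> P1 k).

(** The recipe for the form of a corner, at every position up to the outer border
    of the grid: with these forms the factorizations have no boundary cases. *)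
Definition grid_form i j : S k :=
  pprod (fun a => LX (R a)) (mult lam ^~ j) i * pprod (fun b => LY (Q b)) (mult lam i) j.

Lemma corner_formE c : corner_form R Q c = grid_form c.1 c.2.
Proof.
by congr (_ * _); apply: eq_bigr => a _; rewrite degree_mxE.
Qed.

Variable Z : fat_points k.
Hypotheses (doubleZ : double_points Z) (labelX : ferrers_labelling R Q (finsupp Z)).

Lemma completion_grid a b : completion R Q Z (R a, Q b) = mult lam a b.
Proof.
have [injR injQ XE] := labelX.
rewrite fsfunE in_fsetM /= !in_imfset //= /mult.
have -> : ((R a, Q b) \in finsupp Z) = (b < nth 0 lam a)%N.
  rewrite XE; apply/existsP/idP => [[a' /existsP[b' /andP[h /eqP[ea eb]]]]|h].
    by rewrite (injR _ _ ea) (injQ _ _ eb).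
  by exists a; apply/existsP; exists b; rewrite h eqxx.
case: ifP => // h; rewrite doubleZ // XE.
by apply/existsP; exists a; apply/existsP; exists b; rewrite h eqxx.
Qed.

Lemma completion_supp P : P \in finsupp (completion R Q Z) -> exists a b, P = (R a, Q b).
Proof.
rewrite mem_finsupp fsfunE; case: ifP; rewrite ?eqxx // in_fsetM => /andP[].
case: P => P1 P2 /= /imfsetP[a _ ->] /imfsetP[b _ ->] _.
by exists a, b.
Qed.

Lemma LX_pow_pos (P : P1 k * P1 k) m : (0 < m)%N -> point_ideal P (LX P.1 ^+ m).
Proof.
case: m => // m _; rewrite exprSr; have [_ _ PM] := point_ideal_is_ideal P.
by apply: PM; apply/point_ideal_LX.
Qed.

Lemma LY_pow_pos (P : P1 k * P1 k) m : (0 < m)%N -> point_ideal P (LY P.2 ^+ m).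
Proof.
case: m => // m _; rewrite exprSr; have [_ _ PM] := point_ideal_is_ideal P.
by apply: PM; apply/point_ideal_LY.
Qed.

(** At a point (a, b) of multiplicity 2, either both factors of the form vanish, or
    one of them vanishes twice because the degree matrix decreases. *)
Lemma outer_form_fat i j : (i <= nrows lam)%N -> (j <= ncols lam)%N ->
  i = nrows lam \/ j = ncols lam -> fat_ideal (completion R Q Z) (grid_form i j).
Proof.
move=> ir jt hij P /completion_supp[a [b ->]]; rewrite completion_grid.
set P0 := (R a, Q b).
have idP := point_ideal_is_ideal P0.
have idP2 : is_ideal (ideal_pow (point_ideal P0) 2) by apply: ideal_gen_is_ideal.
have [_ _ PM] := idP; have [_ _ P2M] := idP2.
have hX : (a < i)%N -> point_ideal P0 (pprod (fun a => LX (R a)) (mult lam ^~ j) i).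
  by apply: (pprod_ideal (a := a)) => //; apply: (LX_pow_pos P0); apply: mult_gt0.
have hY : (b < j)%N -> point_ideal P0 (pprod (fun b => LY (Q b)) (mult lam i) j).
  by apply: (pprod_ideal (a := b)) => //; apply: (LY_pow_pos P0); apply: mult_gt0.
rewrite {1}/mult; case: ifP => hb; last first.
  apply: ideal_pow1; case: hij => e.
    by rewrite /grid_form mulrC; apply: PM; apply: hX; rewrite e.
  by apply: PM; apply: hY; rewrite e.
have [ai|ia] := ltnP a i; have [bj|jb] := ltnP b j.
- by apply: mul_ideal_pow2; [apply: hX | apply: hY].
- rewrite /grid_form mulrC; apply: P2M; apply: (pprod_ideal (a := a)) => //.
  by rewrite /mult (leq_ltn_trans jb hb) expr2; apply: mul_ideal_pow2;
    apply: (LX_pow_pos P0 (m := 1)).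
- apply: P2M; apply: (pprod_ideal (a := b)) => //.
  rewrite /mult (leq_trans hb (lam_noninc ia)) expr2.
  by apply: mul_ideal_pow2; apply: (LY_pow_pos P0 (m := 1)).
- by exfalso; case: hij => e; move: (ltn_ord a) (ltn_ord b); lia.
Qed.

Lemma form_point i j (a : 'I_(nrows lam)) (b : 'I_(ncols lam)) :
  (a < i)%N || (b < j)%N -> point_ideal (R a, Q b) (grid_form i j).
Proof.
have idP := point_ideal_is_ideal (R a, Q b); have [_ _ PM] := idP.
case/orP=> h; rewrite /grid_form; last apply: PM; first (rewrite mulrC; apply: PM).
  by apply: pprod_ideal h => //; apply: (LX_pow_pos (R a, Q b)); apply: mult_gt0.
by apply: pprod_ideal h => //; apply: (LY_pow_pos (R a, Q b)); apply: mult_gt0.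
Qed.

Lemma point_ideal_pprod P n (L : 'I_n -> S k) e i :
  point_ideal P (pprod L e i) -> exists2 a : 'I_n, (a < i)%N & point_ideal P (L a).
Proof.
rewrite /pprod; elim/big_rec: _ => [/point_ideal1 //|a p ai IHp].
case/point_idealM => [|//]; elim: (e a) => [/point_ideal1 //|m IHm].
by rewrite exprS => /point_idealM[|//]; exists a.
Qed.

Lemma form_notin_point i j (a : 'I_(nrows lam)) (b : 'I_(ncols lam)) :
  (i <= a)%N -> (j <= b)%N -> ~ point_ideal (R a, Q b) (grid_form i j).
Proof.
have [injR injQ _] := labelX => ia jb /point_idealM[] /point_ideal_pprod[c ci].
  by move/point_ideal_LX => /injR ec; move: ci; rewrite ec; lia.
by move/point_ideal_LY => /injQ ec; move: ci; rewrite ec; lia.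
Qed.

Lemma foldl_ideal_ext_sub (J : S k -> Prop) s f :
  J f -> foldl (fun J c => ideal_ext J (corner_form R Q c)) J s f.
Proof. by elim: s J => //= c s IHs J Jf; apply/IHs/sub_ideal_ext. Qed.

Lemma foldl_ideal_ext_mem (J : S k -> Prop) s c : c \in s ->
  foldl (fun J c => ideal_ext J (corner_form R Q c)) J s (corner_form R Q c).
Proof.
elim: s J => //= d s IHs J; rewrite inE => /orP[/eqP->|/IHs //].
by apply/foldl_ideal_ext_sub/mem_ideal_ext.
Qed.

Lemma foldl_ideal_ext_min (J J' : S k -> Prop) s : is_ideal J' ->
  (forall f, J f -> J' f) -> {in s, forall c, J' (corner_form R Q c)} ->
  forall f, foldl (fun J c => ideal_ext J (corner_form R Q c)) J s f -> J' f.
Proof.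
move=> idJ'; elim: s J => //= c s IHs J JJ' hs; apply: IHs => [f|d ds]; last first.
  by apply: hs; rewrite inE ds orbT.
apply: ideal_gen_min => // g [/JJ' //|->]; apply: hs; exact: mem_head.
Qed.

Variable l : 'I_(size (corners lam)).

Lemma corner_idealS :
  corner_ideal R Q Z l.+1 = ideal_ext (corner_ideal R Q Z l) (corner_form R Q (corner l)).
Proof.
rewrite /corner_ideal (take_nth (corner l)) ?ltn_ord // -cornerE.
by rewrite foldl_rcons.
Qed.

(** Where nothing has been cleared, every generator of the ideal still vanishes. *)
Lemma corner_ideal_point (a : 'I_(nrows lam)) (b : 'I_(ncols lam)) f :
  ~~ cleared l a b -> corner_ideal R Q Z l f -> point_ideal (R a, Q b) f.
Proof.
move=> /hasPn ncl; have idP := point_ideal_is_ideal (R a, Q b).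
apply: foldl_ideal_ext_min => // [g hg|c hc]; last first.
  by rewrite corner_formE; apply: form_point; have := ncl c hc; lia.
apply: (@ideal_pow_sub _ _ (mult lam a b)) => //; first exact: mult_gt0.
rewrite -completion_grid; apply: hg.
by rewrite mem_finsupp completion_grid -lt0n mult_gt0.
Qed.

Lemma outer_form_mem i j : (i <= nrows lam)%N -> (j <= ncols lam)%N ->
  i = nrows lam \/ j = ncols lam -> corner_ideal R Q Z l (grid_form i j).
Proof. by move=> ir jt hij; apply/foldl_ideal_ext_sub/outer_form_fat. Qed.

Lemma larger_corner_form_mem i j : is_corner lam i j ->
  ((corner l).1 < i)%N || ((corner l).1 == i :> nat) && ((corner l).2 < j)%N ->
  corner_ideal R Q Z l (grid_form i j).
Proof.
move=> cij lt; have [ir jt] := is_corner_grid lam_noninc cij.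
have := corner_formE (Ordinal ir, Ordinal jt) => /= <-.
apply: foldl_ideal_ext_mem.
by rewrite mem_take_corners //= cij.
Qed.

End Forms.

(** * Adding the form of a corner *)

Lemma alpha_noninc (k : closedFieldType) (X : {fset P1 k * P1 k}) a b :
  (a <= b)%N -> (nth 0 (alpha X) b <= nth 0 (alpha X) a)%N.
Proof.
move=> ab; have [br|rb] := ltnP b (size (alpha X)); last by rewrite nth_default.
have sorted_alpha : sorted geq (alpha X).
  by apply: sort_sorted => m n; exact: leq_total.
have geq_trans : transitive geq by move=> x y z /= h1 h2; apply: leq_trans h2 h1.
by apply: (sorted_leq_nth geq_trans leqnn 0%N sorted_alpha);
  rewrite ?inE ?(leq_ltn_trans ab).
Qed.

Theorem theorem4p4 (k : closedFieldType) (chark : [pchar k] =i pred0)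
    (Z : fat_points k) (doubleZ : double_points Z) (acmX : ACM (finsupp Z))
    (lam : seq nat) (lamE : lam = alpha (finsupp Z))
    (R : 'I_(nrows lam) -> P1 k) (Q : 'I_(ncols lam) -> P1 k)
    (labelX : ferrers_labelling R Q (finsupp Z))
    (l : 'I_(size (corners lam)))
    (n2 n1 n0 : nat) (F2 : n2.-tuple (int * int)) (F1 : n1.-tuple (int * int))
    (F0 : n0.-tuple (int * int)) :
  let i := (corner l).1 in
  let j := (corner l).2 in
  let m := deg_mx lam l in
  let u := (\sum_(a < nrows lam | (a < i)%N) m a j)%N in
  let v := (\sum_(b < ncols lam | (b < j)%N) m i b)%N in
  let a := (\sum_(a < nrows lam | (i <= a)%N) m a j)%N in
  let b := (\sum_(b < ncols lam | (j <= b)%N) m i b)%N in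
  minimal_free_resolution F2 F1 F0 (corner_ideal R Q Z l) ->
  minimal_free_resolution
    (free_sum F2 (twist (u + a) (v + b)))
    (free_sum (free_sum F1 (twist (u + a) v)) (twist u (v + b)))
    (free_sum F0 (twist u v))
    (corner_ideal R Q Z l.+1).
Proof.
have noninc : forall a b, (a <= b)%N -> (nth 0 lam b <= nth 0 lam a)%N.
  by rewrite lamE; apply: alpha_noninc.
move=> i j m u v a b resI.
have [i' [j' [/andP[ii' i'r] /andP[jj' j't] hi' hj' [mcol mrow rect]]]] :=
  corner_rectangle noninc l.
rewrite -/i -/j -/m in ii' jj' hi' hj' mcol mrow rect.
have cij : is_corner lam i j := corner_is_corner noninc l.
have /andP[drop_row lij] := corner_row_drop noninc cij ii' hi'.
have [c [ci jc cj']] := corner_col_drop noninc cij jj' hj'.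
pose LXR (a : 'I_(nrows lam)) := LX (R a); pose LYQ (b : 'I_(ncols lam)) := LY (Q b).
(* F = (p * f) * (q * g), where p and q collect the exponents that remain in the
   next corner column j' and in the next corner row i' *)
pose p := pprod LXR (mult lam ^~ j') i.
pose f := pprod LXR (fun a => mult lam a j - mult lam a j')%N i.
pose A := \prod_(a < nrows lam | (i <= a < i')%N) LXR a.
pose q := pprod LYQ (mult lam i') j.
pose g := pprod LYQ (fun b => mult lam i b - mult lam i' b)%N j.
pose B := \prod_(b < ncols lam | (j <= b < j')%N) LYQ b.
have mult1 a0 b0 : (i <= a0)%N -> (j <= b0)%N -> mult lam a0 b0 = 1%N.
  by move=> ia jb; have := noninc _ _ ia; rewrite /mult; case: ifP => //; lia.
have rowE : pprod LXR (mult lam ^~ j) i = p * f.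
  by apply: pprod_split => a0; apply: leq_mult => //; apply: ltnW.
have colE : pprod LYQ (mult lam i) j = q * g.
  by apply: pprod_split => b0; apply: leq_mult => //; apply: ltnW.
have row'E j0 : (j <= j0)%N ->
    pprod LXR (mult lam ^~ j0) i' = pprod LXR (mult lam ^~ j0) i * A.
  move=> jj0; apply: pprod_ext; first exact: ltnW.
  by move=> a0 /andP[ia _]; apply: mult1.
have col'E i0 : (i <= i0)%N ->
    pprod LYQ (mult lam i0) j' = pprod LYQ (mult lam i0) j * B.
  move=> ii0; apply: pprod_ext; first exact: ltnW.
  by move=> b0 /andP[jb _]; apply: mult1.
have degX := @bihomog_prod k _ LXR (bd 1 0) _ _ (fun a => @bihomog_LX k (R a)).
have degY := @bihomog_prod k _ LYQ (bd 0 1) _ _ (fun b => @bihomog_LY k (Q b)).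
have degp : bihomog (bd (\sum_(a < nrows lam | (a < i)%N) mult lam a j') 0) p.
  by have := degX (fun a => a < i)%N (fun a => mult lam a j'); rewrite bdMn mul1n.
have degf : bihomog (bd (\sum_(a < nrows lam | (a < i)%N) (mult lam a j - mult lam a j')) 0) f.
  by have := degX (fun a => a < i)%N (fun a => mult lam a j - mult lam a j')%N; rewrite bdMn mul1n.
have degA : bihomog (bd a 0) A.
  have := degX (fun a => i <= a)%N (fun a => m a j); rewrite bdMn mul1n.
  congr (bihomog _ _); rewrite /A big_mkcondr; apply: eq_bigr => a0 ia.
  by rewrite mcol ltnNge ia /=; case: ifP.
have degq : bihomog (bd 0 (\sum_(b < ncols lam | (b < j)%N) mult lam i' b)) q.
  by have := degY (fun b => b < j)%N (fun b => mult lam i' b); rewrite bdMn mul1n.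
have degg : bihomog (bd 0 (\sum_(b < ncols lam | (b < j)%N) (mult lam i b - mult lam i' b))) g.
  by have := degY (fun b => b < j)%N (fun b => mult lam i b - mult lam i' b)%N; rewrite bdMn mul1n.
have degB : bihomog (bd 0 b) B.
  have := degY (fun b => j <= b)%N (fun b => m i b); rewrite bdMn mul1n.
  congr (bihomog _ _); rewrite /B big_mkcondr; apply: eq_bigr => b0 jb.
  by rewrite mrow ltnNge jb /=; case: ifP.
rewrite corner_idealS // corner_formE -/i -/j /grid_form -/LXR -/LYQ rowE colE.
have -> : u = (\sum_(a < nrows lam | (a < i)%N) mult lam a j' +
               \sum_(a < nrows lam | (a < i)%N) (mult lam a j - mult lam a j'))%N.
  rewrite -big_split /=; apply: eq_bigr => a0 ai.
  by rewrite mcol ai subnKC //; apply: leq_mult => //; apply: ltnW.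
have -> : v = (\sum_(b < ncols lam | (b < j)%N) mult lam i' b +
               \sum_(b < ncols lam | (b < j)%N) (mult lam i b - mult lam i' b))%N.
  rewrite -big_split /=; apply: eq_bigr => b0 bj.
  by rewrite mrow bj subnKC //; apply: leq_mult => //; apply: ltnW.
have I1 : corner_ideal R Q Z l (grid_form R Q i' j).
  case: hi' => [e|ci']; last by apply: larger_corner_form_mem; rewrite // ii'.
  by apply: outer_form_mem => //; [apply: ltnW | left].
have I2 : corner_ideal R Q Z l (grid_form R Q i j').
  case: hj' => [e|cj'']; last by apply: larger_corner_form_mem; rewrite // jj' eqxx orbT.
  by apply: outer_form_mem => //; [apply: ltnW | right].
have I3 : corner_ideal R Q Z l (grid_form R Q i' j').
  have [e|ci'] := hi'; first by apply: outer_form_mem => //; left.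
  have [e|cj''] := hj'; first by apply: outer_form_mem => //; right.
  apply: larger_corner_form_mem => //; last by rewrite ii'.
  case/is_cornerP: ci' cj'' => ri' _ /is_cornerP[_ [k0 [k0i rk ej']]].
  by apply/is_cornerP; split=> //; exists k0; split=> //; apply: leq_trans k0i (ltnW ii').
pose rs := [seq R a | a : 'I_(nrows lam) <- enum 'I_(nrows lam) & (i <= a < i')%N].
pose qs := [seq Q b | b : 'I_(ncols lam) <- enum 'I_(ncols lam) & (j <= b < j')%N].
have AE : A = \prod_(P <- rs) LX P by rewrite big_map big_filter big_enum_cond.
have BE : B = \prod_(P <- qs) LY P by rewrite big_map big_filter big_enum_cond.
have [injR injQ _] := labelX.
have urs : uniq rs by rewrite map_inj_uniq // filter_uniq // enum_uniq.
have uqs : uniq qs by rewrite map_inj_uniq // filter_uniq // enum_uniq.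
have idm : is_ideal (@irrelevant k) by apply: ideal_gen_is_ideal.
apply: resolution_add_corner degp degf degA degq degg degB _ _ _ _ _ _ _ _ _ _ resI.
- (* the line of row c occurs in f *)
  apply: (pprod_ideal (a := Ordinal (ltn_trans ci (ltn_ord i)))) => //=.
  by rewrite /mult jc ltnNge cj' expr1; apply: irrelevant_LX.
- rewrite /A (bigD1 i) /= ?leqnn ?ii' // mulrC; apply: irrelevantM; apply: irrelevant_LX.
- (* the line of the column with index nth 0 lam i' occurs in g *)
  have lt : (nth 0 lam i' < ncols lam)%N by lia.
  apply: (pprod_ideal (a := Ordinal lt)) => //=; last by apply: leq_trans drop_row _.
  by rewrite /mult drop_row ltnn expr1; apply: irrelevant_LY.
- rewrite /B (bigD1 j) /= ?leqnn ?jj' // mulrC; apply: irrelevantM; apply: irrelevant_LY.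
- by rewrite BE prod_LY_neq0.
- by rewrite -rowE -row'E.
- by rewrite -colE -col'E.
- by rewrite -row'E 1?ltnW // -col'E 1?ltnW.
- move=> x; rewrite -rowE -colE AE BE => xI; apply: points_on_grid => //.
  move=> _ _ /mapP[a0 + ->] /mapP[b0 + ->]; rewrite !mem_filter => /andP[/andP[ia ai'] _].
  case/andP=> /andP[jb bj'] _.
  have := corner_ideal_point doubleZ labelX (rect _ _ ai' bj' ia jb) xI.
  by case/point_idealM => // /(form_notin_point labelX ia jb).
- by move=> s t; rewrite AE BE; apply: lines_regular.
Qed.
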